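(* Let $(f(n))_{n\ge 5}$ be a sequence of non-negative integers and let $\mathfrak{G}=\prod_{n=5}^\infty \mathrm{Alt}(n)^{f(n)}$ be the corresponding Cartesian product of alternating groups. If $\mathfrak{G}$ is topologically finitely generated, then $\mathfrak{G}$ is a profinite completion, i.e. there exists a finitely generated residually finite group $G$ whose profinite completion $\widehat{G}$ is isomorphic to $\mathfrak{G}$.
   Context: $\mathrm{Alt}(n)$ is the alternating group on $n$ letters. A Cartesian product of finite groups is regarded as a profinite group with the product topology (finite groups being discrete). A profinite group is topologically finitely generated if it has a dense finitely generated subgroup. A profinite group $\mathfrak{G}$ is called a profinite completion if there is a finitely generated residually finite (abstract) group $G$ with $\mathfrak{G}\simeq\widehat{G}$, where $\widehat{G}$ is the inverse limit of all finite quotients of $G$. *)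

(* Defs.v *)
From HB Require Import structures.
From mathcomp Require Import all_boot all_fingroup all_solvable generic_quotient.
From mathcomp Require Import boolp classical_sets cardinality topology.

Set Implicit Arguments.
Unset Strict Implicit.
Unset Printing Implicit Defensive.

Local Open Scope classical_set_scope.
Local Open Scope group_scope.
Local Open Scope quotient_scope.

HB.mixin Record isTopGroup G of monoid.Group G & Topological G := {
  mulg_continuous : continuous (fun p : G * G => p.1 * p.2);
  invg_continuous : continuous (fun x : G => x^-1)
}.

#[short(type="topGroupType")]
HB.structure Definition TopGroup :=
  {G of monoid.Group G & Topological G & isTopGroup G}.

Definition topgroup_iso (G H : topGroupType) : Prop :=
  exists (f : G -> H) (g : H -> G),
    [/\ cancel f g, cancel g f, {morph f : x y / x * y},
        continuous f & continuous g].

Section DiscreteGroup.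
Variable G : groupType.
Local Notation D := (discrete_topology G).

HB.instance Definition _ := monoid.Group.copy D G.

Fact discrete_mulg_continuous : continuous (fun p : D * D => p.1 * p.2).
Proof.
move=> p A /principal_filterP Ap.
by exists ([set p.1], [set p.2]); [split; exact: discrete_set1
  | move=> q [/= -> ->]].
Qed.

Fact discrete_invg_continuous : continuous (fun x : D => x^-1).
Proof.
move=> x A /principal_filterP Ax.
by apply/principal_filterP.
Qed.

HB.instance Definition _ :=
  isTopGroup.Build D discrete_mulg_continuous discrete_invg_continuous.
End DiscreteGroup.

Section ProductGroup.
Variables (I : Type) (T : I -> topGroupType).
Local Notation P := (prod_topology T).

Let mulp (x y : P) : P := fun i => x i * y i.
Let onep : P := fun=> 1.
Let invp (x : P) : P := fun i => (x i)^-1.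

Fact prod_mulA : associative mulp.
Proof. by move=> x y z; apply: functional_extensionality_dep => i; apply: mulgA. Qed.
Fact prod_mul1 : left_id onep mulp.
Proof. by move=> x; apply: functional_extensionality_dep => i; apply: mul1g. Qed.
Fact prod_mulr1 : right_id onep mulp.
Proof. by move=> x; apply: functional_extensionality_dep => i; apply: mulg1. Qed.
Fact prod_mulV : left_inverse onep invp mulp.
Proof. by move=> x; apply: functional_extensionality_dep => i; apply: mulVg. Qed.
Fact prod_mulrV : right_inverse onep invp mulp.
Proof. by move=> x; apply: functional_extensionality_dep => i; apply: mulgV. Qed.

HB.instance Definition _ := isGroup.Build P
  prod_mulA prod_mul1 prod_mulr1 prod_mulV prod_mulrV.

Fact prod_proj_continuous i : continuous (fun x : P => x i).
Proof.
move=> x A /(@initial_continuous P (T i) (fun f : P => f i) x) xA.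
by have /cvg_sup/(_ i) : x --> x by []; apply.
Qed.

Fact prod_continuous (X : topologicalType) (F : X -> P) :
  (forall i, continuous (fun x => F x i)) -> continuous F.
Proof.
move=> cF x; apply/cvg_sup => i.
exact: (@continuous_comp_initial _ _ _ (fun f : P => f i) F (cF i)).
Qed.

Fact prod_mulg_continuous : continuous (fun p : P * P => p.1 * p.2).
Proof.
apply: prod_continuous => i p.
apply: (@continuous_comp _ _ _ (fun p : P * P => (p.1 i, p.2 i))
  (fun q : T i * T i => q.1 * q.2)); last exact: mulg_continuous.
apply: cvg_pair.
  apply: (@continuous_comp _ _ _ (@fst P P) (fun x : P => x i)).
    exact: cvg_fst.
  exact: prod_proj_continuous.
apply: (@continuous_comp _ _ _ (@snd P P) (fun x : P => x i)).
  exact: cvg_snd.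
exact: prod_proj_continuous.
Qed.

Fact prod_invg_continuous : continuous (fun x : P => x^-1).
Proof.
apply: prod_continuous => i x.
apply: (@continuous_comp _ _ _ (fun x : P => x i) (fun y : T i => y^-1)).
  exact: prod_proj_continuous.
exact: invg_continuous.
Qed.

HB.instance Definition _ :=
  isTopGroup.Build P prod_mulg_continuous prod_invg_continuous.
End ProductGroup.

Section AbstractGroups.
Variable G : groupType.

Definition is_subgroup (H : set G) : Prop :=
  [/\ H 1, (forall x y, H x -> H y -> H (x * y))
         & (forall x, H x -> H x^-1)].

Definition generated_subgroup (S : set G) : set G := smallest is_subgroup S.

Definition finitely_generated : Prop :=
  exists2 S : set G, finite_set S & generated_subgroup S = setT.

Record normal_subgroup := NormalSubgroup {
  normal_set :> set G;
  normal_is_subgroup : is_subgroup normal_set;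
  normal_conj : forall x g, normal_set x -> normal_set (x ^ g)
}.

Section Quotient.
Variable N : normal_subgroup.

Definition coset_rel : rel G := fun x y => x^-1 * y \in (N : set G).

Fact coset_rel_refl : reflexive coset_rel.
Proof. by move=> x; apply/mem_set; rewrite mulVg; case: (normal_is_subgroup N). Qed.
Fact coset_rel_sym : symmetric coset_rel.
Proof.
have [_ _ NV] := normal_is_subgroup N.
by move=> x y; apply/idP/idP => /set_mem/NV/mem_set; rewrite invgM invgK.
Qed.
Fact coset_rel_trans : transitive coset_rel.
Proof.
have [_ NM _] := normal_is_subgroup N.
move=> y x z /set_mem xy /set_mem yz; apply/mem_set.
by have := NM _ _ xy yz; rewrite -mulgA mulKVg.
Qed.

Canonical coset_equiv :=
  EquivRel coset_rel coset_rel_refl coset_rel_sym coset_rel_trans.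

Definition quotient_group : Type := {eq_quot coset_equiv}.
HB.instance Definition _ := Choice.on quotient_group.
HB.instance Definition _ := EqQuotient.on quotient_group.

Local Notation Q := quotient_group.
Let mulq (u v : Q) : Q := \pi_Q (repr u * repr v).
Let oneq : Q := \pi_Q 1.
Let invq (u : Q) : Q := \pi_Q (repr u)^-1.

Fact eq_coset x y : (\pi_Q x = \pi_Q y) <-> normal_set N (x^-1 * y).
Proof.
split=> [/eqP|xy]; first by rewrite pi_eq_quot => /set_mem.
by apply/eqP; rewrite pi_eq_quot; apply/mem_set.
Qed.

Let repr_coset x : normal_set N (x^-1 * repr (\pi_Q x)).
Proof. by apply/eq_coset; rewrite reprK. Qed.

Let pi_mulq x y : \pi_Q (x * y) = mulq (\pi_Q x) (\pi_Q y).
Proof.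
have [_ NM _] := normal_is_subgroup N.
apply/eq_coset; set a := repr (\pi_Q x); set b := repr (\pi_Q y).
have := NM _ _ (repr_coset y) (normal_conj b (repr_coset x)).
by rewrite -/a -/b conjgE invgM !mulgA mulgK.
Qed.

Let pi_invq x : \pi_Q x^-1 = invq (\pi_Q x).
Proof.
have [_ _ NV] := normal_is_subgroup N.
apply/eq_coset; rewrite invgK.
have := NV _ (normal_conj x^-1 (repr_coset x)).
by rewrite conjgE invgK !mulgA mulgV mul1g invgM invgK.
Qed.

Fact quotient_mulA : associative mulq.
Proof.
elim/quotW=> x; elim/quotW=> y; elim/quotW=> z.
by rewrite -[mulq (\pi y) _]pi_mulq -[mulq (\pi x) (\pi y)]pi_mulq
  -[LHS]pi_mulq -[RHS]pi_mulq mulgA.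
Qed.
Fact quotient_mul1 : left_id oneq mulq.
Proof. by elim/quotW=> x; rewrite -[LHS]pi_mulq mul1g. Qed.
Fact quotient_mulr1 : right_id oneq mulq.
Proof. by elim/quotW=> x; rewrite -[LHS]pi_mulq mulg1. Qed.
Fact quotient_mulV : left_inverse oneq invq mulq.
Proof.
by elim/quotW=> x; rewrite -[invq _]pi_invq -[LHS]pi_mulq mulVg.
Qed.
Fact quotient_mulrV : right_inverse oneq invq mulq.
Proof.
by elim/quotW=> x; rewrite -[invq _]pi_invq -[LHS]pi_mulq mulgV.
Qed.

HB.instance Definition _ := isGroup.Build Q
  quotient_mulA quotient_mul1 quotient_mulr1 quotient_mulV quotient_mulrV.

Lemma quotient_piM x y : \pi_Q (x * y) = \pi_Q x * \pi_Q y.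
Proof. exact: pi_mulq. Qed.
Lemma quotient_piV x : \pi_Q x^-1 = (\pi_Q x)^-1.
Proof. exact: pi_invq. Qed.
End Quotient.

(* The projection G / N -> G / M; it is meaningful when N is contained in M,
   see quotient_map_pi. *)
Definition quotient_map (N M : normal_subgroup) (u : quotient_group N) :
  quotient_group M := \pi_(quotient_group M) (repr u).

Lemma quotient_map_pi (N M : normal_subgroup) (x : G) :
  (N : set G) `<=` M ->
  quotient_map M (\pi_(quotient_group N) x) = \pi_(quotient_group M) x.
Proof.
move=> NM; apply/esym/eq_coset/NM.
by apply/eq_coset; rewrite reprK.
Qed.

Record finite_quotient := FiniteQuotient {
  finite_quotient_normal :> normal_subgroup;
  finite_quotient_finite : finite_set [set: quotient_group finite_quotient_normal]
}.

Definition residually_finite : Prop :=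
  forall g : G, g <> 1 ->
    exists N : finite_quotient, g \notin (N : set G).

(* The inverse limit of the finite quotients of G, which are indexed by the
   normal subgroups of finite index ordered by inclusion, is the subspace of
   coherent families in the product of the (discrete) quotients. *)
Definition coherent :
    set (prod_topology
           (fun N : finite_quotient => discrete_topology (quotient_group N))) :=
  [set x | forall N M : finite_quotient, (N : set G) `<=` M ->
     quotient_map M (x N) = x M].

Definition profinite_completion : Type := set_type coherent.
HB.instance Definition _ := Topological.on profinite_completion.

Lemma quotient_mapM (N M : normal_subgroup) : (N : set G) `<=` M ->
  {morph quotient_map M : u v / u * v :> quotient_group N >-> u * v}.
Proof.
move=> NM u v; rewrite -(reprK u) -(reprK v) -quotient_piM.
by rewrite !quotient_map_pi // quotient_piM.
Qed.
Lemma quotient_mapV (N M : normal_subgroup) : (N : set G) `<=` M ->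
  {morph quotient_map M : u / u^-1 :> quotient_group N >-> u^-1}.
Proof.
move=> NM u; rewrite -(reprK u) -quotient_piV.
by rewrite !quotient_map_pi // quotient_piV.
Qed.

Local Notation C := profinite_completion.

Fact coherent1 : coherent 1.
Proof. by move=> N M NM; apply: quotient_map_pi. Qed.
Fact coherentM x y : coherent x -> coherent y -> coherent (x * y).
Proof.
move=> cx cy N M NM.
have := quotient_mapM NM (x N) (y N).
by rewrite cx // cy.
Qed.
Fact coherentV x : coherent x -> coherent x^-1.
Proof.
move=> cx N M NM; have := quotient_mapV NM (x N).
by rewrite cx.
Qed.

Let mulc (x y : C) : C :=
  SigSub (mem_set (coherentM (set_mem (valP x)) (set_mem (valP y)))).
Let onec : C := SigSub (mem_set coherent1).
Let invc (x : C) : C := SigSub (mem_set (coherentV (set_mem (valP x)))).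

Fact completion_mulA : associative mulc.
Proof. by move=> x y z; apply: val_inj; apply: mulgA. Qed.
Fact completion_mul1 : left_id onec mulc.
Proof. by move=> x; apply: val_inj; apply: mul1g. Qed.
Fact completion_mulr1 : right_id onec mulc.
Proof. by move=> x; apply: val_inj; apply: mulg1. Qed.
Fact completion_mulV : left_inverse onec invc mulc.
Proof. by move=> x; apply: val_inj; apply: mulVg. Qed.
Fact completion_mulrV : right_inverse onec invc mulc.
Proof. by move=> x; apply: val_inj; apply: mulgV. Qed.

HB.instance Definition _ := isGroup.Build C completion_mulA completion_mul1
  completion_mulr1 completion_mulV completion_mulrV.

Let W : topGroupType := prod_topology
  (fun N : finite_quotient => discrete_topology (quotient_group N)).
Let valW (x : C) : W := \val x.

Let valW_continuous : continuous valW.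
Proof. exact: (@initial_continuous C _ valW). Qed.

Fact completion_mulg_continuous : continuous (fun p : C * C => p.1 * p.2).
Proof.
apply: (@continuous_comp_initial _ _ W valW (fun p : C * C => p.1 * p.2)) => p.
have c1 : {for p, continuous (fun p : C * C => valW p.1)}.
  by apply: (@continuous_comp _ _ _ (@fst C C) valW);
    [exact: cvg_fst | exact: valW_continuous].
have c2 : {for p, continuous (fun p : C * C => valW p.2)}.
  by apply: (@continuous_comp _ _ _ (@snd C C) valW);
    [exact: cvg_snd | exact: valW_continuous].
apply: (@continuous_comp _ _ _ (fun p : C * C => (valW p.1, valW p.2))
  (fun q : W * W => q.1 * q.2)); last exact: mulg_continuous.
exact: (cvg_pair c1 c2).
Qed.

Fact completion_invg_continuous : continuous (fun x : C => x^-1).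
Proof.
apply: (@continuous_comp_initial _ _ W valW (fun x : C => x^-1)) => x.
apply: (@continuous_comp _ _ _ valW (fun y : W => y^-1)).
  exact: valW_continuous.
exact: invg_continuous.
Qed.

HB.instance Definition _ := isTopGroup.Build C
  completion_mulg_continuous completion_invg_continuous.
End AbstractGroups.

Definition topologically_finitely_generated (G : topGroupType) : Prop :=
  exists2 S : set G, finite_set S & dense (generated_subgroup S).

Definition is_profinite_completion (P : topGroupType) : Prop :=
  exists G : groupType,
    [/\ finitely_generated G, residually_finite G
      & topgroup_iso P (profinite_completion G)].

Definition alternating_group (n : nat) : topGroupType :=
  discrete_topology [subg 'Alt_('I_n)].

Definition power_group (G : topGroupType) (k : nat) : topGroupType :=
  prod_topology (fun _ : 'I_k => G).

(* The values f 0, ..., f 4 are not used. *)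
Definition alternating_product (f : nat -> nat) : topGroupType :=
  prod_topology (fun n : {n : nat | (5 <= n)%N} =>
    power_group (alternating_group (sval n)) (f (sval n))).

(* Main.v *)
From HB Require Import structures.
From mathcomp Require Import all_boot all_fingroup all_solvable.
From mathcomp Require Import ssralg zmodp zify.
Require Import Defs.

(** Call an element of [P = prod_n Alt(n)^f(n)] finitely supported if its
coordinates are trivial for all large [n]. Let [G] be a finitely generated dense
subgroup of [P] which contains all finitely supported elements, and suppose that
no nontrivial finite quotient of [G] kills all of them. Then [P] is the profinite
completion of [G]: a finite quotient of [G] kills the simple groups [Alt(n)] for
large [n], so composing it with the truncation of [G] to these [n] kills the
finitely supported elements, hence everything.

To build such a [G], let [Z = X^(l+1) * Y] with [|X| = 5], where [l] tends to
infinity with [n], and put three disjoint copies of [Z] (the fibres) inside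
the [n] points. Let [A], [B] be noncommuting even permutations of [X], acting on one
coordinate of one fibre, and let [x] be the cyclic shift of the coordinates. For
each [m > 0] the commutator [[A^(x^m), B]] is trivial as soon as [m <= l]; so if
the finitely supported elements and [x^m] are killed, then so is [[A, B]], and
with it the simple group [Alt(3 X)], which contains the 3-cycle [c] of the fibres.
For an involution [V] of [Z], the permutation [D] which is [V] on two of the
fibres satisfies [D D^c = D^(c^-1)], so [D] is killed as well; and [x] is a
product of two such [D]. Every even permutation of [n >= 15] points is a product
of 14 conjugates of such permutations [D], so [G] can be made to contain the given
topological generators of [P]. The commutators above, with [m] the order of the
[n]-th component of [x], show that [G] contains the finitely supported
elements. *)

Set Implicit Arguments.
Unset Strict Implicit.
Unset Printing Implicit Defensive.

Local Open Scope group_scope.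

(** * Permutations extended along an injection *)

Lemma morph_commg (G H : groupType) (h : G -> H) :
  {morph h : x y / x * y} -> {morph h : x y / [~ x, y]}.
Proof.
move=> hM x y; have h1 : h 1 = 1 by apply: (mulgI (h 1)); rewrite -hM !mulg1.
have hV z : h z^-1 = (h z)^-1 by apply: (mulgI (h z)); rewrite -hM !mulgV.
by rewrite !commgEl !conjgE !hM !hV.
Qed.

Section LiftPerm.
Variables (T U : finType) (e : T -> U).

Definition plift_fun (p : {perm T}) (u : U) : U :=
  if [pick t | e t == u] is Some t then e (p t) else u.

(** [insubd] with default 1 makes [plift] total; for injective [e] the default is never reached, by
    [pliftV]. *)
Definition plift (p : {perm T}) : {perm U} := insubd (1 : {perm U}) (finfun (plift_fun p)).

Hypothesis e_inj : injective e.

Lemma plift_funE p t : plift_fun p (e t) = e (p t).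
Proof.
rewrite /plift_fun; case: pickP => [t' /eqP/e_inj -> //|/(_ t)].
by rewrite eqxx.
Qed.

Lemma plift_fun_out p u : (forall t, e t != u) -> plift_fun p u = u.
Proof.
by move=> eu; rewrite /plift_fun; case: pickP => // t; rewrite (negPf (eu t)).
Qed.

Lemma plift_fun_inj p : injective (plift_fun p).
Proof.
apply: (can_inj (g := plift_fun p^-1)) => u.
have [/existsP[t /eqP <-]|/existsPn eu] := boolP [exists t, e t == u].
  by rewrite !plift_funE permK.
by rewrite !plift_fun_out.
Qed.

Lemma pliftV p u : plift p u = plift_fun p u.
Proof.
rewrite -pvalE val_insubd ifT ?ffunE //.
by apply/injectiveP => x y; rewrite !ffunE; apply: plift_fun_inj.
Qed.

Lemma pliftE p t : plift p (e t) = e (p t).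
Proof. by rewrite pliftV plift_funE. Qed.

Lemma plift_out p u : (forall t, e t != u) -> plift p u = u.
Proof. by move=> eu; rewrite pliftV plift_fun_out. Qed.

Lemma plift_eq (p : {perm T}) (q : {perm U}) :
  (forall t, q (e t) = e (p t)) -> (forall u, (forall t, e t != u) -> q u = u) ->
  plift p = q.
Proof.
move=> qe q_out; apply/permP => u.
have [/existsP[t /eqP <-]|/existsPn eu] := boolP [exists t, e t == u].
  by rewrite pliftE qe.
by rewrite plift_out ?q_out.
Qed.

Lemma pliftM : {morph plift : p q / p * q}.
Proof.
move=> p q; apply: plift_eq => [t|u eu]; first by rewrite !permM !pliftE.
by rewrite permM !plift_out.
Qed.

Lemma plift1 : plift 1 = 1.
Proof. by apply: plift_eq => [t|u]; rewrite !perm1. Qed.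

Lemma plift_inj : injective plift.
Proof.
by move=> p q /permP pq; apply/permP => t; apply: e_inj; rewrite -!pliftE pq.
Qed.

Lemma odd_plift p : plift p = p :> bool.
Proof.
have [ts -> _] := prod_tpermP p.
elim: ts => [|ab ts IHts]; first by rewrite !big_nil plift1 !odd_perm1.
rewrite !big_cons pliftM !odd_permM IHts; congr (_ (+) _).
rewrite (_ : plift _ = tperm (e ab.1) (e ab.2)) ?odd_tperm ?(inj_eq e_inj) //.
apply: plift_eq => [t|u eu]; first by rewrite inj_tperm.
by rewrite tpermD.
Qed.
End LiftPerm.

Lemma inj_card_exists (T U : finType) :
  #|T| <= #|U| -> exists e : T -> U, injective e.
Proof.
move=> TU; exists (fun t => enum_val (widen_ord TU (enum_rank t))) => t t'.
by move=> /enum_val_inj [/val_inj/enum_rank_inj].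
Qed.

(** Removing the images of [S] takes equally many points from [T] and from [U], so the complement in
    [T] still injects into the complement in [U]. *)
Lemma extend_inj (S T U : finType) (al : S -> T) (be : S -> U) :
  injective al -> injective be -> #|T| <= #|U| ->
  exists2 e : T -> U, injective e & forall s, e (al s) = be s.
Proof.
move=> al_inj be_inj TU.
have [h h_inj] : exists h : {t | t \notin codom al} -> {u | u \notin codom be},
    injective h.
  have cardE (V : finType) (f : S -> V) :
      injective f -> #|S| + #|{: {v | v \notin codom f}}| = #|V|.
    by move=> f_inj; rewrite card_sig -(cardC (mem (codom f))) card_codom.
  by apply: inj_card_exists; rewrite -(leq_add2l #|S|) !cardE.
have codomVN x : (exists s, x = al s) \/ x \notin codom al.
  by case: (boolP (x \in codom al)) => [/codomP|]; [left|right].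
have [|e eP] := @fin_all_exists T (fun=> U) (fun t u =>
    (forall s, al s = t -> u = be s) /\
    (forall nH : t \notin codom al, u = val (h (exist _ t nH)))).
  move=> t; have [[s ->]|nH] := codomVN t.
    exists (be s); split=> [s' /al_inj -> //|nH]; exfalso.
    by case/negP: (nH); rewrite codom_f.
  exists (val (h (exist _ t nH))); split=> [s Es|nH'].
    by case/negP: (nH); rewrite -Es codom_f.
  by rewrite (bool_irrelevance nH nH').
exists e => [t t'|s]; last by have [/(_ s erefl) -> _] := eP (al s).
have [[s Es]|nH] := codomVN t; have [[s' Es']|nH'] := codomVN t'.
- by have [/(_ s (esym Es)) -> _] := eP t; have [/(_ s' (esym Es')) -> _] := eP t';
    rewrite Es Es' => /be_inj ->.
- have [/(_ s (esym Es)) -> _] := eP t; have [_ /(_ nH') ->] := eP t'.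
  by move=> E; have := valP (h (exist _ t' nH')); rewrite -E codom_f.
- have [/(_ s' (esym Es')) -> _] := eP t'; have [_ /(_ nH) ->] := eP t.
  by move=> E; have := valP (h (exist _ t nH)); rewrite E codom_f.
have [_ /(_ nH) ->] := eP t; have [_ /(_ nH') ->] := eP t'.
by move=> /val_inj/h_inj [].
Qed.

(** * Products of disjoint transpositions *)

(** A cycle is a rotation, hence a product of two reflections. With a base point [b] on each orbit,
    [u] sends [h b] to [h^-1 b] for [h] in [<[s]>]; this is well defined because [<[s]>] is abelian,
    and [u * s] has the same shape. *)
Lemma perm_involutions (T : finType) (s : {perm T}) :
  exists u v : {perm T}, [/\ s = u * v, u * u = 1 & v * v = 1].
Proof.
(* The pick depends only on the orbit as a set, so [b] is constant on orbits; the default is never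
   reached. *)
pose b x := odflt x [pick y in porbit s x].
have b_in x : b x \in porbit s x.
  by rewrite /b; case: pickP => [//|/(_ x)]; rewrite porbit_id.
have b_orb x y : y \in porbit s x -> b y = b x.
  rewrite -eq_porbit_mem => /eqP E; rewrite /b E.
  by case: pickP => // /(_ x); rewrite porbit_id.
have [|g gP] := @fin_all_exists T (fun=> {perm T})
    (fun x h => h \in <[s]> /\ h (b x) = x).
  move=> x; have := b_in x; rewrite porbit_sym => /porbitP[i xE].
  by exists (s ^+ i); rewrite mem_cycle.
have comm_s h h' : h \in <[s]> -> h' \in <[s]> -> commute h h'.
  by move=> hs h's; apply: (centsP (cycle_abelian s)).
pose uf x := (g x)^-1 (b x).
have ufE h x : h \in <[s]> -> uf (h (b x)) = h^-1 (b x).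
  move=> hs; have [] := gP (h (b x)); rewrite /uf.
  have -> : b (h (b x)) = b x.
    rewrite (b_orb (b x)) ?(b_orb x) //.
    by have /cycleP[i ->] := hs; apply/porbitP; exists i.
  set k := g _ => ks kE.
  rewrite -[in RHS](permK k (b x)) kE -!permM.
  by rewrite (comm_s k^-1) ?groupV // mulKVg.
have gx x : x = g x (b x) by case: (gP x).
have g_s x : g x \in <[s]> by case: (gP x).
have uf_inv : involutive uf.
  by move=> x; rewrite {2}/uf ufE ?groupV // invgK -gx.
pose u := perm (inv_inj uf_inv).
have uu : u * u = 1 by apply/permP => x; rewrite permM !permE uf_inv.
exists u, (u * s); split=> //; first by rewrite mulgA uu mul1g.
apply/permP => x; rewrite !permM !permE /=.
have -> : s (uf x) = (s^-1 * g x)^-1 (b x) by rewrite invMg invgK permM.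
have sg : s^-1 * g x \in <[s]> by rewrite groupM ?groupV ?cycle_id.
by rewrite ufE ?groupV // invgK -permM -(comm_s s) ?cycle_id // mulgA mulgV mul1g -gx.
Qed.

Section DisjointTranspositions.
Variable T : finType.
Implicit Types (L : seq (T * T)) (p : T * T).

Definition tprod L : {perm T} := \prod_(p <- L) tperm p.1 p.2.
Definition pts L := flatten [seq [:: p.1; p.2] | p <- L].

Lemma pts_cat L1 L2 : pts (L1 ++ L2) = pts L1 ++ pts L2.
Proof. by rewrite /pts map_cat flatten_cat. Qed.

Lemma tprod_cat L1 L2 : tprod (L1 ++ L2) = tprod L1 * tprod L2.
Proof. exact: big_cat. Qed.

Lemma size_pts L : size (pts L) = (size L).*2.
Proof. by elim: L => //= p L ->; rewrite doubleS. Qed.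

Lemma mem_pts L p : p \in L -> p.1 \in pts L /\ p.2 \in pts L.
Proof.
elim: L => //= q L IH; rewrite !inE => /orP[/eqP <-|/IH [p1 p2]].
  by rewrite !eqxx !orbT.
by rewrite p1 p2 !orbT.
Qed.

Lemma tprod_out L x : x \notin pts L -> tprod L x = x.
Proof.
elim: L => [|p L IH] /=; first by rewrite /tprod big_nil perm1.
rewrite !inE !negb_or => /and3P[xp1 xp2 /IH].
by rewrite /tprod big_cons permM tpermD // eq_sym.
Qed.

Lemma tprod_in L p : uniq (pts L) -> p \in L ->
  tprod L p.1 = p.2 /\ tprod L p.2 = p.1.
Proof.
elim: L => [//|q L IH] /=; rewrite !inE negb_or.
move=> /and3P[/andP[q12 q1] q2 uL] pqL.
have [pL|npL] := boolP (p \in L).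
  have [p1 p2] := mem_pts pL.
  have neq x y : x \notin pts L -> y \in pts L -> x != y.
    by move=> xL yL; apply: contraNneq xL => ->.
  rewrite /tprod big_cons !permM.
  rewrite (tpermD (neq _ _ q1 p1) (neq _ _ q2 p1)).
  by rewrite (tpermD (neq _ _ q1 p2) (neq _ _ q2 p2)); apply: IH.
have -> : p = q by move: pqL; rewrite (negPf npL) orbF => /eqP.
by rewrite /tprod big_cons !permM tpermL tpermR !tprod_out.
Qed.

Lemma odd_tprod L : uniq (pts L) -> odd_perm (tprod L) = odd (size L).
Proof.
elim: L => [|p L IH] /=; first by rewrite /tprod big_nil odd_perm1.
rewrite !inE negb_or => /and3P[/andP[p12 _] _ uL].
by rewrite /tprod big_cons odd_permM odd_tperm p12 IH.
Qed.

(** Induction on the number of moved points: split off the transposition of a moved [x] with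
    [u x]. *)
Lemma involution_tprod (u : {perm T}) : u * u = 1 ->
  exists2 L, uniq (pts L) & u = tprod L.
Proof.
move=> uu; have [m] := ubnP #|[set x | u x != x]|; elim: m => // m IH in u uu *.
have uK x : u (u x) = x by rewrite -permM uu perm1.
have [/existsP[x ux] um|] := boolP [exists x, u x != x]; last first.
  move=> /existsPn u1 _; exists [::] => //; rewrite /tprod big_nil.
  by apply/permP => x; rewrite perm1; apply/eqP; rewrite -[_ == _]negbK u1.
pose u' := tperm x (u x) * u.
have u'E y : u' y = if (y == x) || (y == u x) then y else u y.
  rewrite permM; case: tpermP => [->|->|/eqP/negPf -> /eqP/negPf -> //].
  - by rewrite eqxx uK.
  by rewrite eqxx orbT.
have u'u' : u' * u' = 1.
  apply/permP => y; rewrite permM perm1 (u'E y).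
  case: ifP => yx; first by rewrite u'E yx.
  rewrite u'E uK (inj_eq perm_inj) -{1}(uK x) (inj_eq perm_inj) orbC.
  by rewrite yx.
have [|L uL u'L] := IH u' u'u'.
  rewrite -ltnS (leq_trans _ um) // ltnS; apply: proper_card.
  apply/properP; split.
    apply/subsetP => y; rewrite !inE u'E; case: ifP => //.
    by rewrite eqxx.
  by exists x; rewrite !inE ?u'E ?eqxx.
have L_moved y : u' y = y -> y \notin pts L.
  move=> u'y; apply/negP => /flattenP[_ /mapP[p pL ->]].
  have [p1 p2] := tprod_in uL pL; rewrite -u'L in p1 p2.
  have p12 : p.1 != p.2.
    apply: contraTneq uL => E; case/splitPr: pL => L1 L2.
    by rewrite pts_cat cat_uniq /= E !inE eqxx /= !andbF.
  rewrite !inE => /orP[] /eqP yE.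
    by move: p12; rewrite -p1 -yE u'y eqxx.
  by move: p12; rewrite -p2 -yE u'y eqxx.
exists ((x, u x) :: L) => /=; last first.
  by rewrite /tprod big_cons -/(tprod L) -u'L mulgA tperm2 mul1g.
by rewrite inE negb_or eq_sym ux uL !L_moved // u'E eqxx ?orbT.
Qed.

End DisjointTranspositions.

(** * Alternating groups *)

Lemma Alt_not_abelian (T : finType) : 4 < #|T| -> ~~ abelian 'Alt_T.
Proof.
by move=> T5; apply: contraFN (solvable_AltF T5) => /abelian_sol.
Qed.

Lemma Alt_noncommuting (T : finType) : 4 < #|T| ->
  exists a b : {perm T}, [/\ a \in 'Alt_T, b \in 'Alt_T & [~ a, b] != 1].
Proof.
move=> /Alt_not_abelian/subsetPn[a aA]; rewrite -sub_cent1.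
move=> /subsetPn[b bA /cent1P ab]; exists a, b; split=> //.
by apply/commgP => /commute_sym.
Qed.

Lemma Alt_normal_subgroup (T : finType) (H : {group {perm T}}) :
  4 < #|T| -> H <| 'Alt_T -> H :!=: 1 -> H :=: 'Alt_T.
Proof.
move=> /simple_Alt5/simpleP[_ simpA] /simpA[->|->] //.
by rewrite eqxx.
Qed.

(** The even [p] with even image form a normal subgroup of the simple group ['Alt_T], and it
    contains all commutators of even permutations. *)
Lemma even_morph (T U : finType) (h : {perm T} -> {perm U}) :
  4 < #|T| -> {morph h : p q / p * q} ->
  forall p, p \in 'Alt_T -> h p \in 'Alt_U.
Proof.
move=> T5 hM.
have h1 : h 1 = 1 by apply: (mulgI (h 1)); rewrite -hM !mulg1.
have hV p : h p^-1 = (h p)^-1.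
  by apply: (mulgI (h p)); rewrite -hM !mulgV.
pose H := [set p : {perm T} | ~~ odd_perm p && ~~ odd_perm (h p)].
have gH : group_set H.
  apply/group_setP; split=> [|p q]; rewrite !inE ?h1 ?odd_perm1 //.
  by rewrite hM !odd_permM => /andP[/negPf-> /negPf->] /andP[/negPf-> /negPf->].
have nH : Group gH <| 'Alt_T.
  apply/andP; split; first by apply/subsetP => p; rewrite inE Alt_even => /andP[].
  apply/subsetP => p _; rewrite inE; apply/subsetP => _ /imsetP[q qH ->].
  move: qH; rewrite !inE conjgE !hM hV !odd_permM !odd_permV.
  by case: (odd_perm p) (odd_perm q) (odd_perm (h p)) (odd_perm (h q)) => [] [] [] [].
have [a [b [aA bA ab]]] := Alt_noncommuting T5.
have odd_comm V (c d : {perm V}) : odd_perm [~ c, d] = false.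
  rewrite commgEl conjgE !odd_permM !odd_permV.
  by case: (odd_perm c) (odd_perm d) => [] [].
have : Group gH :=: 'Alt_T.
  apply: Alt_normal_subgroup => //; apply/trivgPn; exists [~ a, b] => //.
  have -> : [~ a, b] \in Group gH = ([~ a, b] \in H) by [].
  by rewrite inE odd_comm !(hM, hV, commgEl, conjgE) -conjgE -commgEl odd_comm.
move/setP => E p pA; move: (E p); rewrite pA => pH.
by have : p \in H by []; rewrite inE Alt_even => /andP[].
Qed.

(** * The three fibres *)

Section Fibres.
Variable Z : finType.
Implicit Types (V W : {perm Z}) (e : 'I_3).

Lemma pair_inj e : injective (pair e : Z -> 'I_3 * Z).
Proof. by move=> z z' []. Qed.

Definition fib e V : {perm 'I_3 * Z} := plift (pair e) V.

Lemma fibE e V e' z : fib e V (e', z) = (e', if e' == e then V z else z).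
Proof.
rewrite /fib; case: eqP => [->|/eqP ne]; first by rewrite pliftE //; apply: pair_inj.
rewrite plift_out //; first exact: pair_inj.
by move=> t; rewrite xpair_eqE eq_sym (negPf ne).
Qed.

Lemma fibM e : {morph fib e : V W / V * W}.
Proof. exact/pliftM/pair_inj. Qed.

Lemma fib1 e : fib e 1 = 1.
Proof. exact/plift1/pair_inj. Qed.

Lemma fib_inj e : injective (fib e).
Proof. exact/plift_inj/pair_inj. Qed.

Lemma odd_fib e V : odd_perm (fib e V) = odd_perm V.
Proof. exact/odd_plift/pair_inj. Qed.

(** Two copies of [V] make an even permutation whatever the sign of [V]; the third fibre is kept
    free for [double_rot3]. *)
Definition double V := fib ord0 V * fib (inord 1) V.

Lemma doubleE V e z : double V (e, z) = (e, if e == ord_max then z else V z).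
Proof.
rewrite permM !fibE -!val_eqE /= inordK //.
by case: e => [[|[|[|]]] ?].
Qed.

Lemma double_even V : double V \in 'Alt_('I_3 * Z).
Proof. by rewrite Alt_even odd_permM !odd_fib addbb. Qed.

Lemma doubleM : {morph double : V W / V * W}.
Proof.
move=> V W; apply/permP => -[e z]; rewrite permM !doubleE.
by case: eqP => // _; rewrite permM.
Qed.

Lemma double1 : double 1 = 1.
Proof. by apply/permP => -[e z]; rewrite doubleE !perm1; case: eqP. Qed.

Definition rot_fun (ez : 'I_3 * Z) := (ordS ez.1, ez.2).
Lemma rot_inj : injective rot_fun.
Proof.
move=> [e z] [e' z'] /eqP.
by rewrite xpair_eqE => /andP[/eqP/(@ordS_inj 3) /= -> /eqP /= ->].
Qed.
Definition rot3 := perm rot_inj.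

Lemma rot3E e z : rot3 (e, z) = (ordS e, z).
Proof. by rewrite permE. Qed.

Lemma rot3_cube : rot3 ^+ 3 = 1.
Proof.
apply/permP => -[e z]; rewrite !expgS expg0 mulg1 !permM !rot3E perm1.
by congr (_, _); apply: val_inj; case: e => [[|[|[|]]] ?].
Qed.

Lemma fibJ e V : fib e V ^ rot3 = fib (ordS e) V.
Proof.
apply/permP => -[e' z]; rewrite conjgE.
have -> : (e', z) = rot3 (ord_pred e', z) by rewrite rot3E ord_predK.
rewrite !permM permK fibE !rot3E ord_predK fibE.
by rewrite -(inj_eq (@ordS_inj 3)) ord_predK.
Qed.

(* If [rot3] becomes trivial in a quotient, so does [double V]. *)
Lemma double_rot3 V : V * V = 1 ->
  double V * double V ^ rot3 = double V ^ (rot3 * rot3).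
Proof.
move=> VV; have r0 : ordS (ord0 : 'I_3) = inord 1 by apply: val_inj; rewrite /= inordK.
have r1 : ordS (inord 1 : 'I_3) = ord_max by apply: val_inj; rewrite /= inordK.
have r2 : ordS (ord_max : 'I_3) = ord0 by apply: val_inj.
rewrite conjgM [in double V ^ _](conjMg (fib _ _)) !fibJ r0 r1.
rewrite [in RHS]conjMg !fibJ r1 r2 /double.
have fVV e : fib e V * fib e V = 1.
  by rewrite -fibM VV; apply: (mulgI (fib e 1)); rewrite -fibM !mulg1.
(* The two copies of [V] on fibre 1 cancel, which leaves [V] on fibres 0 and 2. *)
rewrite mulgA -(mulgA (fib ord0 V)) fVV mulg1.
apply/permP => -[e z]; rewrite !permM !fibE -!val_eqE /=.
by case: e => [[|[|[|]]] ?].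
Qed.
End Fibres.

(** * Permutations of coordinates *)

Section Coordinates.
Variables (l : nat) (X Y : finType).
Local Notation Z := ({ffun 'I_l.+1 -> X} * Y)%type.
Implicit Types (p q : 'I_l.+1) (x : {ffun 'I_l.+1 -> X}) (a b : {perm X}).

Definition fset_at p (a : X) x := [ffun q => if q == p then a else x q].

(** [k] acts jointly on the fibre index and on coordinate 0. Thus one simple group,
    ['Alt_('I_3 * X)], accounts both for the even permutations of a single coordinate of fibre 0 and
    for the rotation of the fibres ([corner_fib], [corner_rot3]). *)
Definition corner_fun (k : {perm 'I_3 * X}) (t : 'I_3 * Z) : 'I_3 * Z :=
  let u := k (t.1, t.2.1 ord0) in (u.1, (fset_at ord0 u.2 t.2.1, t.2.2)).

Lemma corner_funM k k' t : corner_fun k' (corner_fun k t) = corner_fun (k * k') t.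
Proof.
case: t => e [x r]; rewrite /corner_fun /= permM ffunE eqxx -surjective_pairing.
by congr (_, (_, _)); apply/ffunP => q; rewrite !ffunE; case: eqP.
Qed.

Lemma corner_fun1 t : corner_fun 1 t = t.
Proof.
case: t => e [x r]; rewrite /corner_fun /= perm1.
by congr (_, (_, _)); apply/ffunP => q; rewrite !ffunE; case: eqP => [->|].
Qed.

Lemma corner_inj k : injective (corner_fun k).
Proof.
by apply: (can_inj (g := corner_fun k^-1)) => t; rewrite corner_funM mulgV corner_fun1.
Qed.

Definition corner k := perm (@corner_inj k).

Lemma cornerM : {morph corner : k k' / k * k'}.
Proof. by move=> k k'; apply/permP => t; rewrite permM !permE corner_funM. Qed.

Lemma corner_rot3 : corner (rot3 X) = rot3 Z.
Proof.
apply/permP => -[e [x r]]; rewrite permE rot3E /corner_fun /= rot3E /=.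
by congr (_, (_, _)); apply/ffunP => q; rewrite !ffunE; case: eqP => [->|].
Qed.

Definition at_fun p a (z : Z) : Z := (fset_at p (a (z.1 p)) z.1, z.2).

Lemma at_funK p a : cancel (at_fun p a) (at_fun p a^-1).
Proof.
move=> [x r]; congr (_, _); apply/ffunP => q; rewrite !ffunE eqxx permK.
by case: eqP => [->|].
Qed.

Definition at_coord p a : {perm Z} := perm (can_inj (@at_funK p a)).

Lemma corner_fib a : corner (fib ord0 a) = fib ord0 (at_coord ord0 a).
Proof.
apply/permP => -[e [x r]]; rewrite fibE permE /corner_fun /= fibE /=; case: eqP => //.
  by rewrite permE.
move=> _; congr (_, (_, _)); apply/ffunP => q; rewrite !ffunE.
by case: eqP => [->|].
Qed.

Lemma at_coord_comm p q a b : p != q ->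
  commute (at_coord p a) (at_coord q b).
Proof.
move=> pq; apply/permP => -[x r]; rewrite !permM !permE; congr (_, _).
apply/ffunP => i; rewrite !ffunE (negPf pq) (eq_sym q) (negPf pq).
by case: (eqVneq i q) => // ->; rewrite eq_sym (negPf pq).
Qed.

(** Subtraction is modulo [l.+1]. The reflections for [j = 0] and [j = 1] are involutions whose
    product is the cyclic shift of the coordinates; this is how the shift becomes a product of two
    doubled involutions. *)
Definition refl_fun (j : 'I_l.+1) (z : Z) : Z :=
  ([ffun i : 'I_l.+1 => z.1 (j - i)%R], z.2).

Lemma refl_funK j : involutive (refl_fun j).
Proof.
move=> [x r]; congr (_, _); apply/ffunP => i; rewrite !ffunE.
by rewrite GRing.subKr.
Qed.

Definition refl j : {perm Z} := perm (inv_inj (refl_funK j)).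

Lemma refl_sq j : refl j * refl j = 1.
Proof. by apply/permP => z; rewrite permM !permE refl_funK. Qed.

Lemma at_coordJ_refl p a j : at_coord p a ^ refl j = at_coord (j - p)%R a.
Proof.
have reflV : (refl j)^-1 = refl j.
  by apply: (mulgI (refl j)); rewrite mulgV refl_sq.
rewrite conjgE reflV; apply/permP => -[x r]; rewrite !permM !permE; congr (_, _).
apply/ffunP => i; rewrite !ffunE !GRing.subKr.
by rewrite -(inj_eq (can_inj (GRing.subKr j))) GRing.subKr.
Qed.

Let shift := double (refl 0%R) * double (refl (inZp 1)).

Lemma at_coordJ_shift a m :
  at_coord ord0 a ^ ((refl 0%R * refl (inZp 1)) ^+ m) = at_coord (inZp m) a.
Proof.
elim: m => [|m IH].
  by rewrite expg0 conjg1; congr at_coord; apply: val_inj; rewrite /= mod0n.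
rewrite expgSr conjgM IH conjgM !at_coordJ_refl; congr at_coord.
rewrite GRing.sub0r GRing.opprK; apply: val_inj => /=.
by rewrite modnDml modnDmr add1n.
Qed.

Lemma fibJ_double (V W : {perm Z}) : fib ord0 V ^ double W = fib ord0 (V ^ W).
Proof.
apply: (mulgI (double W)); rewrite -conjgC; apply/permP => -[e z].
rewrite !permM !fibE !conjgE; case: (eqVneq e ord0) => [->|//].
have /negPf -> : ord0 != inord 1 :> 'I_3 by rewrite -val_eqE /= inordK.
by rewrite !permM permK.
Qed.

(** The [m]-th power of the shift carries coordinate 0 to coordinate [m], a different one as
    [0 < m <= l]; permutations of different coordinates commute. *)
Lemma commg_corner_shift a b m : 0 < m <= l ->
  [~ corner (fib ord0 a) ^ (shift ^+ m), corner (fib ord0 b)] = 1.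
Proof.
move=> m_l; rewrite /shift -doubleM.
have -> : double (refl 0%R * refl (inZp 1)) ^+ m =
   double ((refl 0%R * refl (inZp 1)) ^+ m).
  elim: m {m_l} => [|m IH]; last by rewrite !expgS IH -doubleM.
  rewrite !expg0; exact/esym/double1.
rewrite !corner_fib fibJ_double at_coordJ_shift. apply/eqP/commgP.
rewrite /commute -!fibM at_coord_comm // -val_eqE /= modn_small; lia.
Qed.

Lemma corner1 k : inhabited Y -> corner k = 1 -> k = 1.
Proof.
move=> [r] /permP k1; apply/permP => -[e a]; rewrite perm1.
have := k1 (e, ([ffun=> a], r)); rewrite perm1 permE /corner_fun /= ffunE.
move=> [e1 x1]; have /ffunP/(_ ord0) := x1; rewrite !ffunE eqxx => a1.
by rewrite [k _]surjective_pairing e1 a1.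
Qed.
End Coordinates.

(** * Even permutations as products of doubled involutions *)

Section Structured.
Variables Z U : finType.

Definition structured (w : {perm U}) :=
  exists (e : 'I_3 * Z -> U) (V : {perm Z}),
    [/\ injective e, V * V = 1 & w = plift e (double V)].

Lemma nth_pts (x0 : U) L k (b : bool) : k < size L ->
  nth x0 (pts L) (k.*2 + b) = if b then (nth (x0, x0) L k).2 else (nth (x0, x0) L k).1.
Proof.
by elim: L k => [//|p L IH] [|k] /= kL; [case: (b)|exact: IH].
Qed.

(** The transpositions are grouped in pairs, one of each pair being placed on fibre 0 and the other
    on fibre 1; a single involution [V], exchanging the two ends, then realises both. *)
Lemma structured_tprod (x0 : U) L : uniq (pts L) -> ~~ odd (size L) ->
  size L <= #|Z| -> 3 * #|Z| <= #|U| -> structured (tprod L).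
Proof.
move=> uL evenL LZ ZU; pose t := (size L)./2.
have sizeL : size L = t.*2 by rewrite -[LHS]odd_double_half (negPf evenL).
pose flip (kb : 'I_t * bool) := (kb.1, ~~ kb.2).
have flipK : involutive flip by case=> k b; rewrite /flip /= negbK.
have [nu nu_inj] : exists nu : 'I_t * bool -> Z, injective nu.
  by apply: inj_card_exists; rewrite card_prod card_ord card_bool muln2 -sizeL.
pose fl := perm (inv_inj flipK); pose V := plift nu fl.
have VnuE k b : V (nu (k, b)) = nu (k, ~~ b) by rewrite pliftE // permE.
have VV : V * V = 1.
  rewrite /V -pliftM // -(plift1 nu_inj); congr plift.
  by apply/permP => z; rewrite permM !permE flipK.
(* For [s = (k, b, i)], the point [nu (k, b)] of fibre [i] is matched with the end [b] of the
   transposition number [2k + i]. *)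
pose al (s : 'I_t * bool * bool) : 'I_3 * Z := (if s.2 then inord 1 else ord0, nu s.1).
pose be (s : 'I_t * bool * bool) := nth x0 (pts L) ((s.1.1.*2 + s.2).*2 + s.1.2).
have idx_lt (s : 'I_t * bool * bool) : s.1.1.*2 + s.2 < size L.
  by case: s => [[k b] i] /=; rewrite sizeL; case: i; have := ltn_ord k; lia.
have al_inj : injective al.
  move=> [kb i] [kb' i'] /eqP; rewrite xpair_eqE /= => /andP[E /eqP/nu_inj ->].
  congr (_, _); move: E; rewrite -val_eqE.
  by case: i i' => [] [] //=; rewrite inordK.
have be_inj : injective be.
  move=> [[k b] i] [[k' b'] i'] /eqP.
  have lt_be (s : 'I_t * bool * bool) : (s.1.1.*2 + s.2).*2 + s.1.2 < size (pts L).
    have := idx_lt s; rewrite size_pts; case: s.1.2; lia.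
  rewrite /be nth_uniq ?lt_be //= => /eqP E.
  have Ek : k = k' by apply: val_inj; case: b b' i i' E => [] [] [] [] /=; lia.
  by congr (_, _, _) => //; case: b b' i i' E => [] [] [] [] /=; rewrite Ek; lia.
(* The matching extends to all three fibres because [3 * #|Z| <= #|U|]. *)
have [|e e_inj eE] := extend_inj (T := ('I_3 * Z)%type) al_inj be_inj.
  by rewrite card_prod card_ord.
have beE k b i : be (k, b, i) = if b then (nth (x0, x0) L (k.*2 + i)).2
                                else (nth (x0, x0) L (k.*2 + i)).1.
  by rewrite /be nth_pts // (idx_lt (k, b, i)).
have swap k b i : tprod L (be (k, b, i)) = be (k, ~~ b, i).
  have pL := mem_nth (x0, x0) (idx_lt (k, b, i)).
  by have [p1 p2] := tprod_in uL pL; rewrite !beE; case: (b).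
have in_be u : u \in pts L -> exists s, u = be s.
  move=> /(nthP x0)[m]; rewrite size_pts sizeL => m_lt <-.
  have k_lt : m./2./2 < t by lia.
  exists (Ordinal k_lt, odd m, odd m./2); rewrite /be /=; congr nth; lia.
exists e, V; split=> //; apply/esym/plift_eq => // [[j z]|u eu]; last first.
  by apply/tprod_out/negP => /in_be[s uE]; have := eu (al s); rewrite eE uE eqxx.
have [/codomP[[[k b] i] tE]|jz] := boolP ((j, z) \in codom al).
  rewrite tE eE swap -eE; congr e; rewrite doubleE VnuE; congr (_, _).
  by case: i {tE}; rewrite -val_eqE /= ?inordK.
rewrite tprod_out; last first.
  by apply: contraNN jz => /in_be[s]; rewrite -eE => /e_inj ->; apply: codom_f.
congr e; rewrite doubleE; case: eqP => // j2; congr (_, _).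
rewrite /V plift_out // => -[k b]; apply: contraNneq jz => <-.
apply/codomP; exists (k, b, j == inord 1); congr (_, _).
case: eqP => //= j1; apply: val_inj.
have /eqP := j1; have /eqP := j2; rewrite -!val_eqE /= inordK //.
by case: (j) => [[|[|[|]]] ?].
Qed.
End Structured.

Lemma disjoint_pair (U : finType) (s : seq U) : size s + 2 <= #|U| ->
  exists a b, [/\ a != b, a \notin s & b \notin s].
Proof.
move=> sU; have out (s' : seq U) : size s' < #|U| -> exists a, a \notin s'.
  move=> s'U; apply/existsP; rewrite -[[exists _, _]]negbK; apply/existsPn => all_s'.
  have : #|U| <= size s'; last by rewrite leqNgt s'U.
  apply: leq_trans (card_size s'); apply: subset_leq_card; apply/subsetP => x _.
  by rewrite -[_ \in _]negbK all_s'.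
have [|a a_s] := out s; first by rewrite -addn1 (leq_trans _ sU) // leq_add2l.
have [|b] := out (a :: s); first by rewrite /= -addn2.
by rewrite inE negb_or => /andP[ba b_s]; exists a, b; rewrite eq_sym.
Qed.

Section Products.
Variables Z U : finType.

Fixpoint sprod m (w : {perm U}) :=
  if m is m'.+1 then exists w1 w2, [/\ structured Z w1, sprod m' w2 & w = w1 * w2]
  else w = 1.

Arguments sprod : simpl never.

Lemma sprodM m m' w w' : sprod m w -> sprod m' w' -> sprod (m + m') (w * w').
Proof.
elim: m w => [|m IH] w; first by move=> ->; rewrite mul1g.
move=> [w1 [w2 [w1s w2m ->]]] w'm; exists w1, (w2 * w').
by split; [|exact: IH|rewrite mulgA].
Qed.

Hypotheses (U15 : 15 <= #|U|) (ZU : 3 * #|Z| <= #|U|) (UZ : #|U| <= 6 * #|Z|).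

(** The bound is even, so that full blocks are even permutations, and it is at most [#|U| / 6],
    hence at most [#|Z|]. *)
Lemma structured_small L : uniq (pts L) -> ~~ odd (size L) ->
  size L <= 2 * (#|U| %/ 12) -> @structured Z U (tprod L).
Proof.
move=> uL oL sL; have /card_gt0P[x0 _] : 0 < #|U| by apply: leq_trans U15.
by apply: structured_tprod => //; lia.
Qed.

Lemma sprod_chunks m L : uniq (pts L) -> ~~ odd (size L) ->
  size L <= m * (2 * (#|U| %/ 12)) -> sprod m (tprod L).
Proof.
set h := (2 * _)%N; elim: m L => [|m IH] L uL oL sL.
  by move: sL; rewrite mul0n leqn0 => /nilP ->; rewrite /= /tprod big_nil.
exists (tprod (take h L)), (tprod (drop h L)).
rewrite -tprod_cat cat_take_drop; split=> //.
  apply: structured_small.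
  - by move: uL; rewrite -{1}(cat_take_drop h L) pts_cat cat_uniq => /andP[].
  - by rewrite size_take; case: ifP => //; rewrite /h mul2n odd_double.
  by rewrite size_take -/h; case: ifP; lia.
apply: IH.
- by move: uL; rewrite -{1}(cat_take_drop h L) pts_cat cat_uniq => /and3P[].
- by rewrite size_drop; move: oL; rewrite /h; lia.
by rewrite size_drop; lia.
Qed.

(** There are at most [#|U| / 2] disjoint transpositions. Six blocks have room for
    [12 * (#|U| %/ 12)], which is at least as much since [#|U| >= 12]. *)
Lemma sprod_even_tprod L : uniq (pts L) -> ~~ odd (size L) -> sprod 6 (tprod L).
Proof.
move=> uL oL; apply: sprod_chunks => //.
have : size (pts L) <= #|U| by move/card_uniqP: uL => <-; apply: max_card.
rewrite size_pts; lia.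
Qed.

(** The two involutions of [perm_involutions] have the same sign. If even, each takes 6 factors; if
    odd, one transposition is removed from each, and the product of these two takes 2 factors: 6 + 2
    + 6 = 14. *)
Lemma Alt_sprod (p : {perm U}) : p \in 'Alt_U -> sprod 14 p.
Proof.
have [u [v [-> uu vv]]] := perm_involutions p.
have [L uL ->] := involution_tprod uu; have [L' uL' ->] := involution_tprod vv.
rewrite Alt_even odd_permM !odd_tprod // negb_add => /eqP oLL'.
have s1 : structured Z (1 : {perm U}).
  by have := @structured_small [::] isT isT (leq0n _); rewrite /tprod big_nil.
have [oL|] := boolP (odd (size L)); last first.
  (* Two trivial factors pad 6 + 6 to 14. *)
  move=> oL; rewrite (_ : 14 = 6 + (6 + 2))%N //.
  rewrite -(mulg1 (tprod L')).
  do !apply: sprodM; try by apply: sprod_even_tprod; rewrite -?oLL'.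
  by exists 1, 1; split=> //; [exists 1, 1; split|]; rewrite ?mulg1.
have oL' : odd (size L') by rewrite -oLL'.
case/lastP: L uL oL {oLL'} => [//|L p0].
rewrite -cats1 pts_cat cat_uniq size_cat addn1 /= => /and3P[uL _ up] oL.
case: L' uL' oL' => [//|p1 L'] uL' oL'.
have [uL'2 u1] : uniq (pts L') /\ p1.1 != p1.2.
  by move: uL'; rewrite /= inE negb_or => /and3P[/andP[-> _] _ ->].
(* As [p0] and [p1] may overlap, a transposition [q] disjoint from both is inserted twice:
   [p0 p1 = (p0 q) (q p1)]. *)
have [|q0 [q1 [q01 q0n q1n]]] := disjoint_pair (s := [:: p0.1; p0.2; p1.1; p1.2]).
  exact: leq_trans U15.
have -> : tprod (L ++ [:: p0]) * tprod (p1 :: L') =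
    tprod L * (tprod [:: p0; (q0, q1)] * (tprod [:: (q0, q1); p1] * 1) * tprod L').
  rewrite tprod_cat mulg1 -mulgA; congr (_ * _).
  rewrite -(cat1s p1) -(cat1s p0 [:: _]) -(cat1s (q0, q1)) !tprod_cat !mulgA.
  do 2!congr (_ * _); rewrite -mulgA [X in _ * X](_ : _ = 1) ?mulg1 //.
  by rewrite /tprod big_seq1 tperm2.
have size2 : 2 <= 2 * (#|U| %/ 12) by rewrite leq_pmulr // divn_gt0 // (leq_trans _ U15).
have small (a b : U * U) : a.1 != a.2 -> b.1 != b.2 -> a.1 \notin [:: b.1; b.2] ->
    a.2 \notin [:: b.1; b.2] -> structured Z (tprod [:: a; b]).
  move=> a12 b12; rewrite !inE !negb_or => /andP[n1 n2] /andP[n3 n4].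
  apply: structured_small; [|by []|exact: size2].
  by rewrite /= !inE !negb_or a12 n1 n2 n3 n4 b12.
move: q0n q1n; rewrite !inE !negb_or => /and4P[m1 m2 m3 m4] /and4P[m5 m6 m7 m8].
have u0 : p0.1 != p0.2 by move: up; rewrite /= inE andbT.
rewrite (_ : 14 = 6 + (2 + 6))%N //; apply: sprodM.
  by apply: sprod_even_tprod => //; move: oL; rewrite /= negbK.
apply: sprodM; last by apply: sprod_even_tprod.
exists (tprod [:: p0; (q0, q1)]), (tprod [:: (q0, q1); p1] * 1); split=> //.
  apply: small; rewrite //= !inE !negb_or.
    by rewrite eq_sym m1 eq_sym m5.
  by rewrite eq_sym m2 eq_sym m6.
exists (tprod [:: (q0, q1); p1]), 1; split=> //.
by apply: small; rewrite //= !inE !negb_or ?m3 ?m4 ?m7 ?m8.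
Qed.
End Products.

(** * The size of the fibres *)

Definition ncoord n := (trunc_log 5 (n %/ 3)).-1.
(** For [n >= 15], the exponent [(ncoord n).+1] is the largest for which three copies of that power
    of 5 fit into [n] points. The factor [nrest n] enlarges the cells so that three of them cover at
    least half of the points. *)
Definition nrest n := n %/ (3 * 5 ^ (ncoord n).+1).
Definition cell n : finType := ({ffun 'I_(ncoord n).+1 -> 'I_5} * 'I_(nrest n))%type.

Lemma card_cell n : #|cell n| = (5 ^ (ncoord n).+1 * nrest n)%N.
Proof. by rewrite card_prod card_ffun !card_ord. Qed.

Lemma ncoord_log n : 15 <= n -> (ncoord n).+1 = trunc_log 5 (n %/ 3).
Proof.
move=> n15; rewrite /ncoord prednK // trunc_log_gt0 //=; lia.
Qed.

Lemma pow_ncoord n : 15 <= n -> 3 * 5 ^ (ncoord n).+1 <= n.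
Proof.
move=> n15; rewrite ncoord_log //.
have : 5 ^ trunc_log 5 (n %/ 3) <= n %/ 3 by apply: trunc_logP; lia.
lia.
Qed.

Lemma nrest_gt0 n : 15 <= n -> 0 < nrest n.
Proof.
move=> n15; rewrite divn_gt0; last by rewrite muln_gt0 expn_gt0.
exact: pow_ncoord.
Qed.

Lemma card_cell_le n : 3 * #|cell n| <= n.
Proof. by rewrite card_cell mulnA mulnC leq_divM. Qed.

Lemma card_cell_ge n : 15 <= n -> n <= 6 * #|cell n|.
Proof.
move=> n15; rewrite card_cell; have := nrest_gt0 n15.
have d_gt0 : 0 < 3 * 5 ^ (ncoord n).+1 by rewrite muln_gt0 expn_gt0.
have := ltn_ceil n d_gt0; rewrite -/(nrest n).
move: (5 ^ _)%N (nrest n) => a b; nia.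
Qed.

(** So [ncoord n] tends to infinity, which makes the commutators formed with a fixed power of the
    shift finitely supported. *)
Lemma ncoord_ge m n : 3 * 5 ^ m.+1 <= n -> m <= ncoord n.
Proof.
move=> mn; have n15 : 15 <= n.
  apply: leq_trans mn; rewrite expnS; have := expn_gt0 5 m; lia.
rewrite -ltnS ncoord_log //; apply: trunc_log_max => //; lia.
Qed.

From mathcomp Require Import generic_quotient.
From mathcomp Require Import boolp classical_sets cardinality topology.

Local Open Scope classical_set_scope.
Local Open Scope group_scope.

(** * The Cartesian product *)

Section Product.
Variable f : nat -> nat.
Local Notation P := (alternating_product f).
Local Notation idx := {n : nat | (5 <= n)%N}.
Implicit Types (g h : P) (n : idx).

Definition coord g n (k : 'I_(f (sval n))) : {perm 'I_(sval n)} := sgval (g n k).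

(** [subg] replaces an odd permutation by 1, hence the evenness hypothesis of [of_coordE]. *)
Definition of_coord (s : forall n, 'I_(f (sval n)) -> {perm 'I_(sval n)}) : P :=
  fun n k => subg 'Alt_('I_(sval n)) (s n k).

Lemma coord_even g n k : coord g k \in 'Alt_('I_(sval n)).
Proof. exact: subgP. Qed.

Lemma of_coordE s n k : s n k \in 'Alt_('I_(sval n)) -> coord (of_coord s) k = s n k.
Proof. exact: subgK. Qed.

Lemma coordP g h : (forall n k, coord g k = coord h k :> {perm 'I_(sval n)}) -> g = h.
Proof.
move=> gh; apply: functional_extensionality_dep => n.
by apply: functional_extensionality_dep => k; apply: val_inj; apply: gh.
Qed.

Lemma coordM g h n k : coord (g * h) k = coord g k * coord h k :> {perm 'I_(sval n)}.
Proof. by []. Qed.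
Lemma coordV g n k : coord g^-1 k = (coord g k)^-1 :> {perm 'I_(sval n)}.
Proof. by []. Qed.

Lemma coordJ g h n k : coord (g ^ h) k = coord g k ^ coord h k :> {perm 'I_(sval n)}.
Proof. by rewrite !conjgE !coordM coordV. Qed.

Lemma coordR g h n k : coord [~ g, h] k = [~ coord g k, coord h k] :> {perm 'I_(sval n)}.
Proof. by rewrite !commgEl coordM coordV coordJ. Qed.

Definition supp_lt m : set P :=
  [set g | forall n, (m <= sval n)%N -> forall k, coord g k = 1 :> {perm 'I_(sval n)}].
(** A basis of open normal subgroups: [x^-1 * y] lies in the [m]-th one exactly when [x] and [y]
    agree on all factors below [m]. *)
Definition supp_ge m : set P :=
  [set g | forall n, (sval n < m)%N -> forall k, coord g k = 1 :> {perm 'I_(sval n)}].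

Definition restr (C : forall n, 'I_(f (sval n)) -> bool) g : P :=
  of_coord (fun n k => if C n k then coord g k else 1).

Lemma restrE C g n k :
  coord (restr C g) k = if C n k then coord g k else 1 :> {perm 'I_(sval n)}.
Proof. by rewrite of_coordE //; case: ifP => // _; apply: coord_even. Qed.

Lemma restrM C : {morph restr C : g h / g * h}.
Proof.
by move=> g h; apply: coordP => n k; rewrite !coordM !restrE; case: ifP; rewrite ?mulg1.
Qed.
Lemma restrV C : {morph restr C : g / g^-1}.
Proof.
by move=> g; apply: coordP => n k; rewrite !coordV !restrE; case: ifP; rewrite ?invg1.
Qed.

End Product.

(** * Finite quotients that kill the finitely supported elements *)

Section PartialMorphism.
Variables (P Q : groupType) (H : set P) (psi : P -> Q).
Hypothesis sH : is_subgroup H.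
Hypothesis psiM : forall x y, H x -> H y -> psi (x * y) = psi x * psi y.

Lemma subgroup1 : H 1. Proof. by case: sH. Qed.
Lemma subgroupM x y : H x -> H y -> H (x * y). Proof. by case: sH => _ + _; apply. Qed.
Lemma subgroupV x : H x -> H x^-1. Proof. by case: sH => _ _; apply. Qed.
Lemma subgroupX x m : H x -> H (x ^+ m).
Proof.
by move=> Hx; elim: m => [|m IH]; rewrite ?expg0 ?expgS; [apply: subgroup1|apply: subgroupM].
Qed.
Lemma subgroupJ x y : H x -> H y -> H (x ^ y).
Proof. by move=> Hx Hy; rewrite conjgE; do !apply: subgroupM => //; apply: subgroupV. Qed.
Lemma subgroupR x y : H x -> H y -> H [~ x, y].
Proof.
move=> Hx Hy; rewrite commgEl.
by apply: subgroupM (subgroupJ _ _) => //; apply: subgroupV.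
Qed.

Lemma pmorph1 : psi 1 = 1.
Proof. by apply: (mulgI (psi 1)); rewrite -psiM ?mulg1 //; apply: subgroup1. Qed.
Lemma pmorphV x : H x -> psi x^-1 = (psi x)^-1.
Proof.
move=> Hx; apply: (mulgI (psi x)); rewrite -psiM ?mulgV ?pmorph1 //.
exact: subgroupV.
Qed.
Lemma pmorphX x m : H x -> psi (x ^+ m) = psi x ^+ m.
Proof.
move=> Hx; elim: m => [|m IH]; first by rewrite !expg0 pmorph1.
by rewrite !expgS psiM ?IH //; apply: subgroupX.
Qed.
Lemma pmorphJ x y : H x -> H y -> psi (x ^ y) = psi x ^ psi y.
Proof.
by move=> Hx Hy; rewrite !conjgE !psiM ?pmorphV //; [apply: subgroupV|apply: subgroupM].
Qed.
Lemma pmorphR x y : H x -> H y -> psi [~ x, y] = [~ psi x, psi y].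
Proof.
move=> Hx Hy; rewrite !commgEl psiM ?pmorphV ?pmorphJ //; first exact: subgroupV.
exact: subgroupJ.
Qed.
End PartialMorphism.

Lemma rot3_even (Z : finType) : rot3 Z \in 'Alt_('I_3 * Z).
Proof.
have /(congr1 (@odd_perm _)) := rot3_cube Z.
rewrite !expgS expg0 mulg1 !odd_permM odd_perm1 Alt_even.
by case: (odd_perm _).
Qed.

Section Killing.
Variable f : nat -> nat.
Local Notation P := (alternating_product f).
Local Notation idx := {n : nat | (5 <= n)%N}.
Implicit Types (g h : P) (n : idx).

(** [psi] is a total function that is multiplicative on [H], and [H] is any subgroup containing [F].
    In this form the property is stable under unions and can be used before the group [G] is
    fixed. *)
Definition self_killing (F : set P) :=
  forall (Q : groupType) (H : set P) (psi : P -> Q),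
    is_subgroup H -> (forall x y, H x -> H y -> psi (x * y) = psi x * psi y) ->
    (forall q : Q, exists2 m, (0 < m)%N & q ^+ m = 1) ->
    (forall m g, H g -> supp_lt m g -> psi g = 1) ->
    F `<=` H -> forall x, F x -> psi x = 1.

Variable e : forall n, 'I_(f (sval n)) -> 'I_3 * cell (sval n) -> 'I_(sval n).
Hypothesis e_inj : forall n k, (15 <= sval n)%N -> injective (@e n k).

Local Notation perms := (forall n, 'I_(f (sval n)) -> {perm 'I_3 * cell (sval n)}).
Implicit Types p q : perms.

(** Below 15 points the fibres may not fit, hence the default value 1; these finitely many factors
    are treated separately. *)
Definition lift_family p : P :=
  of_coord (fun n k => if (15 <= sval n)%N then plift (@e n k) (p n k) else 1).

Lemma coord_lift_family p n k : p n k \in 'Alt_('I_3 * cell (sval n)) ->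
  coord (lift_family p) k =
    if (15 <= sval n)%N then plift (@e n k) (p n k) else 1.
Proof.
move=> p_even; rewrite of_coordE //; case: ifP => // n15.
by rewrite Alt_even odd_plift -?Alt_even //; apply: e_inj.
Qed.

Lemma lift_familyM p q :
  (forall n k, p n k \in 'Alt_('I_3 * cell (sval n))) ->
  (forall n k, q n k \in 'Alt_('I_3 * cell (sval n))) ->
  lift_family (fun n k => p n k * q n k) = lift_family p * lift_family q.
Proof.
move=> p_even q_even; apply: coordP => n k.
rewrite coordM !coord_lift_family //; last by rewrite groupM ?p_even ?q_even.
by case: ifP => n15; rewrite ?mulg1 // pliftM //; apply: e_inj.
Qed.

Lemma lift_familyV p :
  (forall n k, p n k \in 'Alt_('I_3 * cell (sval n))) ->
  lift_family (fun n k => (p n k)^-1) = (lift_family p)^-1.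
Proof.
move=> p_even; have pV_even n k : (p n k)^-1 \in 'Alt_('I_3 * cell (sval n)).
  by rewrite groupV p_even.
apply: (mulgI (lift_family p)); rewrite -lift_familyM // mulgV.
apply: coordP => n k; rewrite coord_lift_family ?mulgV ?group1 //.
by case: ifP => // n15; rewrite plift1 //; apply: e_inj.
Qed.

Lemma lift_familyJ p q :
  (forall n k, p n k \in 'Alt_('I_3 * cell (sval n))) ->
  (forall n k, q n k \in 'Alt_('I_3 * cell (sval n))) ->
  lift_family (fun n k => p n k ^ q n k) = lift_family p ^ lift_family q.
Proof.
move=> p_even q_even; rewrite conjgE -lift_familyV // -!lift_familyM //.
- by move=> n k; rewrite ?(groupM, groupV, groupJ, p_even, q_even).
- by move=> n k; rewrite ?(groupM, groupV, groupJ, p_even, q_even).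
Qed.

Lemma lift_familyR p q :
  (forall n k, p n k \in 'Alt_('I_3 * cell (sval n))) ->
  (forall n k, q n k \in 'Alt_('I_3 * cell (sval n))) ->
  lift_family (fun n k => [~ p n k, q n k]) = [~ lift_family p, lift_family q].
Proof.
move=> p_even q_even; rewrite commgEl -lift_familyJ // -lift_familyV // -lift_familyM //.
- by move=> n k; rewrite ?(groupM, groupV, groupJ, p_even, q_even).
- by move=> n k; rewrite ?(groupM, groupV, groupJ, p_even, q_even).
Qed.

Lemma lift_familyX p m :
  (forall n k, p n k \in 'Alt_('I_3 * cell (sval n))) ->
  lift_family (fun n k => p n k ^+ m) = lift_family p ^+ m.
Proof.
move=> p_even; elim: m => [|m IH].
  apply: coordP => n k; rewrite coord_lift_family ?group1 //.
  by case: ifP => // n15; rewrite expg0 plift1 //; apply: e_inj.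
rewrite expgS -IH -lift_familyM //; last by move=> n k; rewrite groupX ?p_even.
congr lift_family; apply: functional_extensionality_dep => n.
by apply: functional_extensionality_dep => k; apply: expgS.
Qed.

Local Notation X := 'I_5.
Implicit Types kappa : {perm 'I_3 * X}.

Definition cell_corner (m : nat) kappa : {perm 'I_3 * cell m} := corner _ _ kappa.
Definition cell_refl (m : nat) (j : 'I_(ncoord m).+1) : {perm cell m} := refl _ _ j.

Definition corner_family kappa : P :=
  lift_family (fun n k => cell_corner (sval n) kappa).
Definition double_family (V : forall n, 'I_(f (sval n)) -> {perm cell (sval n)}) : P :=
  lift_family (fun n k => double (V n k)).

Lemma corner_even (m : nat) kappa : kappa \in 'Alt_('I_3 * X) ->
  cell_corner m kappa \in 'Alt_('I_3 * cell m).
Proof.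
apply: even_morph; last exact: cornerM.
by rewrite card_prod !card_ord.
Qed.

Definition shift_family : P :=
  double_family (fun n k => @cell_refl (sval n) 0%R) *
  double_family (fun n k => @cell_refl (sval n) (inZp 1)).

(** The group ['Alt_('I_3 * X)] acting on all large factors at once, the two involutions whose
    product is the shift, and a freely chosen double, through which a prescribed structured element
    enters the group. *)
Definition generators V : set P :=
  corner_family @` [set kappa | kappa \in 'Alt_('I_3 * X)] `|`
  [set double_family (fun n k => @cell_refl (sval n) 0%R);
       double_family (fun n k => @cell_refl (sval n) (inZp 1)); double_family V].

Lemma generators_finite V : finite_set (generators V).
Proof.
rewrite finite_setU; split; first exact/finite_image/finite_finset.
by rewrite !finite_setU; split; [split|]; apply: finite_set1.
Qed.

Lemma corner_familyM k1 k2 : k1 \in 'Alt_('I_3 * X) -> k2 \in 'Alt_('I_3 * X) ->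
  corner_family (k1 * k2) = corner_family k1 * corner_family k2.
Proof.
move=> k1A k2A; rewrite -lift_familyM; try by move=> n k; apply: corner_even.
congr lift_family; apply: functional_extensionality_dep => n.
by apply: functional_extensionality_dep => k; apply: cornerM.
Qed.

Lemma shift_familyE : shift_family = lift_family (fun n k =>
  double (@cell_refl (sval n) 0%R) * double (@cell_refl (sval n) (inZp 1))).
Proof. by rewrite lift_familyM // => n k; apply: double_even. Qed.

Lemma shift_even (m : nat) :
  double (@cell_refl m 0%R) * double (@cell_refl m (inZp 1)) \in 'Alt_('I_3 * cell m).
Proof. by rewrite groupM ?double_even. Qed.

Section Commutator.
Variables a b : {perm X}.
Hypotheses (aA : a \in 'Alt_X) (bA : b \in 'Alt_X).

Lemma fib_even (c : {perm X}) : c \in 'Alt_X -> fib ord0 c \in 'Alt_('I_3 * X).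
Proof. by rewrite !Alt_even odd_fib. Qed.

Lemma commg_shift_family m :
  [~ corner_family (fib ord0 a) ^ (shift_family ^+ m), corner_family (fib ord0 b)] =
  lift_family (fun n k => [~ cell_corner (sval n) (fib ord0 a) ^
    ((double (@cell_refl (sval n) 0%R) * double (@cell_refl (sval n) (inZp 1))) ^+ m),
    cell_corner (sval n) (fib ord0 b)]).
Proof.
rewrite shift_familyE -lift_familyX -?lift_familyJ -?lift_familyR //;
  move=> n k; rewrite ?(groupJ, groupX) ?corner_even ?fib_even ?shift_even //.
Qed.

Lemma commg_shift_even (m m' : nat) :
  [~ cell_corner m (fib ord0 a) ^
    ((double (@cell_refl m 0%R) * double (@cell_refl m (inZp 1))) ^+ m'),
    cell_corner m (fib ord0 b)] \in 'Alt_('I_3 * cell m).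
Proof. by rewrite groupR ?groupJ ?groupX ?corner_even ?fib_even ?shift_even. Qed.

Lemma supp_commg_shift m : (0 < m)%N -> supp_lt (3 * 5 ^ m.+1)
  [~ corner_family (fib ord0 a) ^ (shift_family ^+ m), corner_family (fib ord0 b)].
Proof.
move=> m_gt0 n n_ge k; rewrite commg_shift_family coord_lift_family ?commg_shift_even //.
case: ifP => // n15; rewrite /cell_corner /cell_refl commg_corner_shift.
  by apply: plift1; apply: e_inj.
by rewrite m_gt0 ncoord_ge.
Qed.

(** For [m] the order of the shift in the factor [n], the conjugation disappears there and
    [[~ a, b]] is left. *)
Lemma commg_shift_neq1 n (k : 'I_(f (sval n))) : [~ a, b] != 1 -> (15 <= sval n)%N ->
  exists2 m, (0 < m)%N & coord [~ corner_family (fib ord0 a) ^ (shift_family ^+ m),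
     corner_family (fib ord0 b)] k != 1 :> {perm 'I_(sval n)}.
Proof.
move=> ab n15.
set s := double (@cell_refl (sval n) 0%R) * double (@cell_refl (sval n) (inZp 1)).
exists #[s]; first exact: order_gt0.
rewrite commg_shift_family coord_lift_family ?commg_shift_even //.
rewrite n15 -(plift1 (@e_inj n k n15)) (inj_eq (plift_inj (@e_inj n k n15))).
rewrite -/s expg_order conjg1; apply: contraNneq ab => E.
have /corner1 : cell_corner (sval n) (fib ord0 [~ a, b]) = 1.
  by rewrite /cell_corner (morph_commg (@fibM _ _)) (morph_commg (@cornerM _ _ _)).
have /[swap]/[apply] : inhabited 'I_(nrest (sval n)).
  by have := nrest_gt0 n15; case: (nrest _) => // r; split; apply: ord0.
by rewrite -(fib1 _ ord0) => /fib_inj ->.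
Qed.
End Commutator.

Lemma Alt_is_subgroup (T : finType) : is_subgroup [set p : {perm T} | p \in 'Alt_T].
Proof.
split=> [|p q pA qA|p pA] /=; first exact: group1.
  by rewrite groupM.
by rewrite groupV.
Qed.

Lemma generators_self_killing V :
  (forall n k, V n k * V n k = 1) -> self_killing (generators V).
Proof.
move=> VV Q H psi sH psiM torsion psi_supp FH.
have H_corner kappa : kappa \in 'Alt_('I_3 * X) -> H (corner_family kappa).
  by move=> kA; apply: FH; left; exists kappa.
have psi_cornerM k1 k2 : k1 \in 'Alt_('I_3 * X) -> k2 \in 'Alt_('I_3 * X) ->
    psi (corner_family (k1 * k2)) = psi (corner_family k1) * psi (corner_family k2).
  by move=> k1A k2A; rewrite corner_familyM ?psiM //; apply: H_corner.
have sA := Alt_is_subgroup ('I_3 * X)%type.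
have H_shift : H shift_family.
  by apply: subgroupM => //; apply: FH; right; left; [left|right].
have [a [b [aA bA ab]]] : exists a b : {perm X},
    [/\ a \in 'Alt_X, b \in 'Alt_X & [~ a, b] != 1].
  by apply: Alt_noncommuting; rewrite card_ord.
(* Some power [m > 0] of the shift has trivial image. The commutator formed with it is finitely
   supported, hence killed, while under [psi] the conjugation disappears. *)
have psiR_ab : psi (corner_family (fib ord0 [~ a, b])) = 1.
  have [m m_gt0 psi_m] := torsion (psi shift_family).
  have Ha := H_corner _ (fib_even aA); have Hb := H_corner _ (fib_even bA).
  have HX := subgroupX sH m H_shift.
  have := psi_supp _ _ (subgroupR sH (subgroupJ sH Ha HX) Hb)
                   (supp_commg_shift aA bA m_gt0).
  rewrite (pmorphR sH psiM (subgroupJ sH Ha HX) Hb) (pmorphJ sH psiM Ha HX).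
  rewrite (pmorphX sH psiM) // psi_m conjg1.
  move <-; rewrite (morph_commg (@fibM _ _)).
  exact: (pmorphR sA psi_cornerM (fib_even aA) (fib_even bA)).
(* The [kappa] killed by [psi] form a normal subgroup of a simple group; it contains [fib ord0
   [~ a, b]], hence is everything. *)
pose K := finset (fun kappa : {perm 'I_3 * X} =>
  (kappa \in 'Alt_('I_3 * X)) && `[< psi (corner_family kappa) = 1 >]).
have KP kappa :
    reflect (kappa \in 'Alt_('I_3 * X) /\ psi (corner_family kappa) = 1) (kappa \in K).
  by rewrite [kappa \in K]finset.in_set; apply: (iffP andP) => -[kA /asboolP kE].
have gK : group_set K.
  apply/group_setP; split=> [|k1 k2 /KP[k1A k1E] /KP[k2A k2E]]; apply/KP.
    by split; [exact: group1|exact: (pmorph1 sA psi_cornerM)].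
  by rewrite groupM // psi_cornerM // k1E k2E mulg1.
have nK : Group gK <| 'Alt_('I_3 * X).
  apply/andP; split; first by apply/fintype.subsetP => k /KP[].
  apply/fintype.subsetP => k kA; rewrite finset.in_set.
  apply/fintype.subsetP => _ /imsetP[q /KP[qA qE] ->]; apply/KP.
  by rewrite groupJ // (pmorphJ sA psi_cornerM) // qE conj1g.
have psi_corner kappa : kappa \in 'Alt_('I_3 * X) -> psi (corner_family kappa) = 1.
  have : Group gK :=: 'Alt_('I_3 * X).
    apply: Alt_normal_subgroup => //; first by rewrite card_prod !card_ord.
    apply/trivgPn; exists (fib ord0 [~ a, b]).
      by apply/KP; split=> //; apply: fib_even; rewrite groupR.
    by apply: contraNneq ab => E; apply/eqP/(@fib_inj _ ord0); rewrite E fib1.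
  by move=> /= <- /KP[].
(* Once the rotation of the fibres is killed, [double_rot3] gives [psi D * psi D = psi D] for the
   double [D]. *)
have psi_double W : (forall n k, W n k * W n k = 1) -> H (double_family W) ->
    psi (double_family W) = 1.
  move=> WW HW; have cA := rot3_even X.
  have := congr1 psi (_ : double_family W * double_family W ^ corner_family (rot3 X) =
    double_family W ^ (corner_family (rot3 X) * corner_family (rot3 X))).
  have Hc := H_corner _ cA.
  rewrite (psiM _ _ HW (subgroupJ sH HW Hc)) (pmorphJ sH psiM HW Hc).
  rewrite (pmorphJ sH psiM HW (subgroupM sH Hc Hc)).
  rewrite (psiM _ _ Hc Hc) psi_corner // mulg1 conjg1 => E.
  apply: (mulgI (psi (double_family W))); rewrite mulg1; apply: E.
  have Wev n k : double (W n k) \in 'Alt_('I_3 * cell (sval n)) by exact: double_even.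
  have Cev (m : nat) : cell_corner m (rot3 X) \in 'Alt_('I_3 * cell m) by exact: corner_even.
  have CCev (m : nat) : cell_corner m (rot3 X * rot3 X) \in 'Alt_('I_3 * cell m).
    by apply: corner_even; rewrite groupM.
  rewrite -corner_familyM // /double_family /corner_family -!lift_familyJ //.
  rewrite -lift_familyM //; last by move=> n k; rewrite groupJ ?Wev ?Cev.
  congr lift_family; apply: functional_extensionality_dep => n.
  apply: functional_extensionality_dep => k.
  by rewrite /cell_corner cornerM !corner_rot3 (double_rot3 (WW n k)).
move=> x [[kappa kA <-]|]; first exact: psi_corner.
move=> Fx; have Hx : H x by apply: FH; right.
by case: Fx Hx => [[] ->|->]; apply: psi_double => //; move=> n k; apply: refl_sq.
Qed.
End Killing.

(** * Choice of the generators *)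

Section Generated.
Variable G : groupType.
Implicit Types (S H : set G).

Lemma generated_is_subgroup S : is_subgroup (generated_subgroup S).
Proof.
split=> [H [[]]|x y Sx Sy H HS|x Sx H HS] //.
  by case: (HS) => [[_ + _] _]; apply; [apply: Sx|apply: Sy].
by case: (HS) => [[_ _ +] _]; apply; apply: Sx.
Qed.

Lemma sub_generated S : S `<=` generated_subgroup S.
Proof. by move=> x Sx H [_]; apply. Qed.

Lemma generated_sub S H : is_subgroup H -> S `<=` H -> generated_subgroup S `<=` H.
Proof. by move=> sH SH x; apply. Qed.
End Generated.

Section Generation.
Variable f : nat -> nat.
Local Notation P := (alternating_product f).
Local Notation idx := {n : nat | (5 <= n)%N}.
Implicit Types (g h : P) (n : idx).

(** A block has two uses: it puts a prescribed structured element into the group, and its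
    commutators are finitely supported elements which detect every coordinate with [n >= 15]. *)
Lemma structured_block (w : forall n, 'I_(f (sval n)) -> {perm 'I_(sval n)}) :
  (forall n k, (15 <= sval n)%N -> structured (cell (sval n)) (w n k)) ->
  exists F : set P,
    [/\ finite_set F, self_killing F,
        F (of_coord (fun n k => if (15 <= sval n)%N then w n k else 1)) &
        forall H, is_subgroup H -> F `<=` H -> forall n (k : 'I_(f (sval n))),
          (15 <= sval n)%N ->
          exists g m, [/\ H g, supp_lt m g & coord g k <> 1 :> {perm 'I_(sval n)}]].
Proof.
move=> w_str.
have eV_ex (nk : {n : idx & 'I_(f (sval n))}) :
    exists eV : ('I_3 * cell (sval (tag nk)) -> 'I_(sval (tag nk))) *
                {perm cell (sval (tag nk))},
    eV.2 * eV.2 = 1 /\ ((15 <= sval (tag nk))%N ->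
      injective eV.1 /\ w (tag nk) (tagged nk) = plift eV.1 (double eV.2)).
  case: nk => n k /=; have [n15|n15] := leqP 15 (sval n).
    by have [e [V [e_inj VV ->]]] := w_str n k n15; exists (e, V).
  have n_gt0 : (0 < sval n)%N by apply: leq_trans (valP n).
  (* A dummy choice for [n < 15], where [eV.1] is not constrained. *)
  by exists (fun=> Ordinal n_gt0, 1); split; rewrite //= mulg1.
pose eV n (k : 'I_(f (sval n))) := sval (cid (eV_ex (Tagged _ k))).
have eVP n k := svalP (cid (eV_ex (@Tagged _ n (fun n => 'I_(f (sval n))) k))).
pose e n k := (@eV n k).1; pose V n k := (@eV n k).2.
have e_inj n (k : 'I_(f (sval n))) : (15 <= sval n)%N -> injective (@e n k).
  by have [_ H] := eVP n k; move=> /H[].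
have VV n (k : 'I_(f (sval n))) : V n k * V n k = 1 by have [] := eVP n k.
have wE : of_coord (fun n k => if (15 <= sval n)%N then w n k else 1) = double_family e V.
  apply: coordP => n k; rewrite !of_coordE //=.
  - by case: ifP => // n15; have [_ /(_ n15)[_ ->]] := eVP n k.
  - case: ifP => // n15; rewrite Alt_even odd_plift -?Alt_even ?double_even //.
    exact: e_inj.
  - case: ifP => // n15; have [_ /(_ n15)[inj ->]] := eVP n k.
    by rewrite Alt_even odd_plift -?Alt_even ?double_even.
exists (generators e V); split.
- exact: generators_finite.
- exact: generators_self_killing.
- by rewrite wE; right; right.
move=> H sH FH n k n15.
have [a [b [aA bA ab]]] : exists a b : {perm 'I_5},
    [/\ a \in 'Alt_('I_5), b \in 'Alt_('I_5) & [~ a, b] != 1].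
  by apply: Alt_noncommuting; rewrite card_ord.
have [m m_gt0 neq1] := commg_shift_neq1 e_inj aA bA k ab n15.
exists [~ corner_family e (fib ord0 a) ^ (shift_family e ^+ m),
     corner_family e (fib ord0 b)], (3 * 5 ^ m.+1)%N; split.
- have Hc (c : {perm 'I_5}) : c \in 'Alt_('I_5) -> H (corner_family e (fib ord0 c)).
    by move=> cA; apply: FH; left; exists (fib ord0 c) => //; apply: fib_even.
  apply: subgroupR => //; last exact: Hc.
  apply: subgroupJ => //; first exact: Hc.
  apply: subgroupX => //; apply: subgroupM => //; apply: FH; right; left; [by left|by right].
- exact: supp_commg_shift.
exact/eqP.
Qed.

Definition killable g :=
  exists F : set P, [/\ finite_set F, self_killing F & generated_subgroup F g].

Lemma self_killingU F1 F2 : self_killing F1 -> self_killing F2 ->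
  self_killing (F1 `|` F2 : set P).
Proof.
move=> k1 k2 Q H psi sH psiM tors psis FH x [Fx|Fx].
  by apply: (k1 _ H _ sH psiM tors psis) Fx => y Fy; apply: FH; left.
by apply: (k2 _ H _ sH psiM tors psis) Fx => y Fy; apply: FH; right.
Qed.

Lemma generated_mono (F1 F2 : set P) : F1 `<=` F2 ->
  generated_subgroup F1 `<=` generated_subgroup F2.
Proof.
move=> F12; apply: generated_sub; first exact: generated_is_subgroup.
by apply: subset_trans F12 _; apply: sub_generated.
Qed.

Lemma killableM g h : killable g -> killable h -> killable (g * h).
Proof.
move=> [F1 [f1 k1 g1]] [F2 [f2 k2 g2]]; exists (F1 `|` F2); split.
- by rewrite finite_setU.
- exact: self_killingU.
apply: (subgroupM (generated_is_subgroup _)).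
  by apply: generated_mono g1; apply: subsetUl.
by apply: generated_mono g2; apply: subsetUr.
Qed.

Lemma killable_supp_lt m g : supp_lt m g -> killable g.
Proof.
move=> gm; exists [set g]; split; [exact: finite_set1| |exact: sub_generated].
by move=> Q H psi sH psiM tors psis gH _ ->; apply: (psis m) => //; apply: gH.
Qed.

(** Induction on the number [r] of factors, which is the same for all [n]: one block removes one
    structured factor at all coordinates simultaneously. *)
Lemma killable_sprod r g :
  (forall n (k : 'I_(f (sval n))), if (15 <= sval n)%N
     then sprod (cell (sval n)) r (coord g k) else coord g k = 1) -> killable g.
Proof.
elim: r g => [|r IH] g g_r.
  apply: (@killable_supp_lt 0) => n _ k.
  by have := g_r n k; case: ifP.
have w_ex n (k : 'I_(f (sval n))) : exists w : {perm 'I_(sval n)}, (15 <= sval n)%N ->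
    structured (cell (sval n)) w /\ sprod (cell (sval n)) r (w^-1 * coord g k).
  have := g_r n k; case: ifP => [n15 [w1 [w2 [s1 s2 ->]]]|_ _]; last by exists 1.
  by exists w1 => _; rewrite mulKg.
pose w n (k : 'I_(f (sval n))) := sval (cid (w_ex n k)).
have wP n (k : 'I_(f (sval n))) (n15 : (15 <= sval n)%N) := svalP (cid (w_ex n k)) n15.
have [|F [F_fin F_kill Fw _]] := @structured_block w.
  by move=> n k /wP - /(_ k)[].
set g1 := of_coord _ in Fw; rewrite (_ : g = g1 * (g1^-1 * g)); last by rewrite mulKVg.
apply: killableM.
  by exists F; split=> //; apply: sub_generated.
apply: IH => n k; rewrite coordM coordV of_coordE.
  have := g_r n k; case: ifP => [n15 _|n15 ->]; last by rewrite invg1 mulg1.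
  by have [_] := wP n k n15.
case: ifP => // n15; have [[e [V [e_inj _ wE]]] _] := wP n k n15.
by rewrite /w wE Alt_even odd_plift -?Alt_even ?double_even.
Qed.

(** The part below 15 is finitely supported, hence killed by assumption; the rest is a product of 14
    structured elements by [Alt_sprod]. *)
Lemma killable_all g : killable g.
Proof.
rewrite (_ : g = restr (fun n _ => (sval n < 15)%N) g *
                 restr (fun n _ => (15 <= sval n)%N) g).
  apply: killableM.
    by apply: (@killable_supp_lt 15) => n n15 k; rewrite restrE ltnNge n15.
  apply: (@killable_sprod 14) => n k; rewrite restrE; case: (leqP 15 (sval n)) => // n15.
  apply: Alt_sprod; rewrite ?card_ord ?coord_even //; first exact: card_cell_le.
  exact: card_cell_ge.
apply: coordP => n k; rewrite coordM !restrE ltnNge.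
by case: (15 <= sval n)%N; rewrite ?mulg1 ?mul1g.
Qed.
End Generation.

Section Generators.
Variable f : nat -> nat.
Local Notation P := (alternating_product f).
Local Notation idx := {n : nat | (5 <= n)%N}.
Implicit Types (g h : P) (n : idx).

Definition coord_detecting (H : set P) := forall n (k : 'I_(f (sval n))),
  exists g m, [/\ H g, supp_lt m g & coord g k <> 1 :> {perm 'I_(sval n)}].

(** [F] unites finite self-killing sets that generate the given topological generators, for density,
    with [F1] and [c], which detect the coordinates with [n >= 15] and [n < 15] respectively. *)
Lemma exists_generators : topologically_finitely_generated P ->
  exists F : set P, [/\ finite_set F, self_killing F,
    dense (generated_subgroup F) & coord_detecting (generated_subgroup F)].
Proof.
move=> [S S_fin S_dense].
pose FS g := sval (cid (killable_all g)).
have FSP g := svalP (cid (killable_all g)).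
(* Here the structured element is trivial; the block serves only for its commutators. *)
have [|F1 [F1_fin F1_kill _ F1_coord]] := @structured_block f (fun n k => 1).
  move=> n k n15; have n_gt0 : (0 < sval n)%N by apply: leq_trans (valP n).
  have := @structured_tprod (cell (sval n)) _ (Ordinal n_gt0) [::] isT isT (leq0n _).
  by rewrite /tprod big_nil card_ord; apply; apply: card_cell_le.
have [c cE] : exists c : P, forall n (k : 'I_(f (sval n))),
    if (15 <= sval n)%N then coord c k = 1 else coord c k != 1.
  have a_ex n : exists a : {perm 'I_(sval n)}, a \in 'Alt_('I_(sval n)) /\ a != 1.
    have [|a [b [aA _ ab]]] := @Alt_noncommuting 'I_(sval n).
      by rewrite card_ord (valP n).
    by exists a; split=> //; apply: contraNneq ab => ->; rewrite comm1g.
  pose a n := sval (cid (a_ex n)); have aP n := svalP (cid (a_ex n)).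
  exists (of_coord (fun n k => if (15 <= sval n)%N then 1 else a n)) => n k.
  have [aA a1] := aP n.
  by rewrite of_coordE; case: (leqP 15 (sval n)) => // _; apply: group1.
exists (\bigcup_(g in S) FS g `|` (F1 `|` [set c])); split.
- rewrite !finite_setU; split; last by split=> //; apply: finite_set1.
  by apply: bigcup_finite => // g _; have [] := FSP g.
- have c_kill : self_killing [set c].
    move=> Q H psi sH psiM tors psis cH _ ->; apply: (psis 15); first exact: cH.
    by move=> n n15 k; have := cE n k; rewrite n15.
  apply: self_killingU; last exact: self_killingU.
  move=> Q H psi sH psiM tors psis FH x [g Sg Fx].
  have [_ k _] := FSP g.
  by apply: (k Q H psi sH psiM tors psis) Fx => y Fy; apply: FH; exists g.
- move=> U U0 Uo; have [x [Ux Sx]] := S_dense U U0 Uo; exists x; split=> //.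
  apply: generated_sub Sx; first exact: generated_is_subgroup.
  move=> g Sg; have [_ _ +] := FSP g; apply: generated_mono => y Fy.
  by left; exists g.
set G := generated_subgroup _ => n k.
have sG : is_subgroup G by apply: generated_is_subgroup.
have [n15|n15] := leqP 15 (sval n).
  have [|g [m [? ? ?]]] := F1_coord G sG _ n k n15; last by exists g, m.
  by apply: subset_trans (@sub_generated _ _) => x ?; right; left.
exists c, 15; split; first by apply: sub_generated; right; right.
  by move=> n' n'15 k'; have := cE n' k'; rewrite n'15.
by have := cE n k; rewrite leqNgt n15 => /eqP.
Qed.
End Generators.

(** * Finitely supported elements *)

Lemma Alt_centerless (T : finType) (r : {perm T}) : 4 < #|T| ->
  r \in 'Alt_T -> r != 1 -> exists2 q, q \in 'Alt_T & [~ r, q] != 1.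
Proof.
move=> T5 rA r1; have Z1 : 'Z('Alt_T) :=: 1.
  apply/eqP; apply: contraTT (Alt_not_abelian T5) => Z_neq1.
  by rewrite negbK -(Alt_normal_subgroup T5 (center_normal _) Z_neq1) center_abelian.
have /subsetPn[q qA qr] : ~~ ('Alt_T \subset 'C[r]).
  apply: contra r1; rewrite sub_cent1 => rC.
  by have /setP/(_ r) := Z1; rewrite finset.in_setI rA rC => /esym; rewrite finset.in_set1.
exists q => //; apply: contra qr => /commgP/commute_sym/cent1P //.
Qed.

Section Coordinates.
Variable f : nat -> nat.
Local Notation P := (alternating_product f).
Local Notation idx := {n : nat | (5 <= n)%N}.
Implicit Types (g h : P) (n : idx).

(** [dfwith] changes the family at the single index [n], without a transport along equalities of
    indices. For the same reason [coord_embed_out] compares [k] and [k'] as natural numbers. *)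
Definition embed n (k : 'I_(f (sval n))) (r : {perm 'I_(sval n)}) : P :=
  dfwith (1 : P) (fun k' : 'I_(f (sval n)) =>
    if k' == k then subg 'Alt_('I_(sval n)) r else 1).

Lemma coord_embed n (k : 'I_(f (sval n))) r : r \in 'Alt_('I_(sval n)) ->
  coord (embed k r) k = r.
Proof. by move=> rA; rewrite /coord /embed dfwith_in eqxx subgK. Qed.

Lemma coord_embed_out n (k : 'I_(f (sval n))) r n' (k' : 'I_(f (sval n'))) :
  (sval n' != sval n) || (k' != k :> nat) ->
  coord (embed k r) k' = 1 :> {perm 'I_(sval n')}.
Proof.
rewrite /coord /embed; have [E|n'n] := eqVneq n n'.
  by case: _ / E k' => k'; rewrite eqxx /= dfwith_in => /negPf k'k; rewrite -val_eqE k'k.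
by rewrite dfwith_out.
Qed.

Lemma embed_coord n (k : 'I_(f (sval n))) g :
  (forall n' (k' : 'I_(f (sval n'))), (sval n' != sval n) || (k' != k :> nat) ->
     coord g k' = 1 :> {perm 'I_(sval n')}) -> g = embed k (coord g k).
Proof.
move=> g_out; apply: coordP => n' k'.
have [/andP[/eqP/val_inj E1 /eqP E2]|out] := boolP ((sval n' == sval n) && (k' == k :> nat)).
  by case: _ / E1 k E2 {g_out} => k /val_inj <-; rewrite coord_embed ?coord_even.
by rewrite negb_and in out; rewrite g_out ?coord_embed_out.
Qed.

Lemma embedM n (k : 'I_(f (sval n))) r q : r \in 'Alt_('I_(sval n)) ->
  q \in 'Alt_('I_(sval n)) -> embed k (r * q) = embed k r * embed k q.
Proof.
move=> rA qA; rewrite [RHS](@embed_coord n k) ?coordM ?coord_embed //.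
by move=> n' k' out; rewrite coordM !coord_embed_out ?mulg1.
Qed.

(** An element with support in finitely many factors is a finite product of its coordinates:
    induction on the factors, then on the coordinates inside the last one. *)
Lemma embed_group_ind N (H : set P) : is_subgroup H ->
  (forall n (k : 'I_(f (sval n))) r, (N <= sval n)%N ->
     r \in 'Alt_('I_(sval n)) -> H (embed k r)) ->
  forall m g, supp_lt m g -> supp_ge N g -> H g.
Proof.
move=> sH H_embed; elim=> [|m IH] g g_lt g_ge.
  by rewrite (_ : g = 1); [exact: (subgroup1 sH)|apply: coordP => n k; rewrite g_lt].
rewrite (_ : g = restr (fun n _ => (sval n < m)%N) g *
                 restr (fun n _ => sval n == m) g); last first.
  apply: coordP => n k; rewrite coordM !restrE; case: ltngtP; rewrite ?mulg1 ?mul1g //.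
  by move=> n_gt; rewrite g_lt.
apply: subgroupM => //.
  apply: IH => n n_m k; rewrite restrE; first by rewrite ltnNge n_m.
  by case: ifP => // _; apply: g_ge.
(* As [j] is any natural number, there may be no such coordinate; the restriction is then
   trivial. *)
have H_one j : H (restr (fun n k => (sval n == m) && (k == j :> nat)) g).
  have [[n [k [Nn nm kj]]]|none] := pselect (exists n (k : 'I_(f (sval n))),
      [/\ (N <= sval n)%N, sval n = m & k = j :> nat]).
    rewrite [restr _ _](@embed_coord n k); first by apply: H_embed => //; apply: coord_even.
    by move=> n' k'; rewrite restrE -nm -kj -negb_and => /negPf ->.
  rewrite (_ : restr _ _ = 1); first exact: (subgroup1 sH).
  apply: coordP => n k; rewrite restrE; case: ifP => // /andP[/eqP nm /eqP kj].
  by apply: g_ge; rewrite ltnNge; apply/negP => Nn; apply: none; exists n, k.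
have H_lt j : H (restr (fun n k => (sval n == m) && (k < j)%N) g).
  elim: j => [|j IHj].
    rewrite (_ : restr _ _ = 1); first exact: (subgroup1 sH).
    by apply: coordP => n k; rewrite restrE andbF.
  rewrite (_ : restr _ _ = restr (fun n k => (sval n == m) && (k < j)%N) g *
     restr (fun n k => (sval n == m) && (k == j :> nat)) g); first exact: subgroupM.
  apply: coordP => n k; rewrite coordM !restrE ltnS leq_eqVlt.
  by case: eqP => //= _; case: (ltngtP k j) => //= _; rewrite ?mulg1 ?mul1g.
rewrite (_ : restr _ _ = restr (fun n k => (sval n == m) && (k < f m)%N) g) //.
apply: coordP => n k; rewrite !restrE; case: eqP => // nm.
by rewrite -nm ltn_ord.
Qed.

Section Subgroup.
Variable G : set P.
Hypothesis sG : is_subgroup G.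
Hypothesis G_dense : forall g m, exists2 x, G x & supp_ge m (x^-1 * g).
Hypothesis G_detect : coord_detecting G.

Lemma G_approx g m : exists2 x, G x & forall n (k : 'I_(f (sval n))), (sval n < m)%N ->
  coord x k = coord g k.
Proof.
have [x Gx xg] := G_dense g m; exists x => // n k nm.
by apply/eqP; rewrite eq_mulVg1 -coordV -coordM xg.
Qed.

(** The [r] whose embedding lies in [G] form a subgroup of the alternating group, normal because by
    density [G] has elements with any prescribed coordinate. It is nontrivial by [G_detect], hence
    everything. *)
Lemma G_embed n (k : 'I_(f (sval n))) r : r \in 'Alt_('I_(sval n)) -> G (embed k r).
Proof.
pose A := finset (fun r : {perm 'I_(sval n)} =>
  (r \in 'Alt_('I_(sval n))) && `[< G (embed k r) >]).
have AP q : reflect (q \in 'Alt_('I_(sval n)) /\ G (embed k q)) (q \in A).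
  by rewrite [q \in A]finset.in_set; apply: (iffP andP) => -[qA /asboolP Gq].
have n5 : 4 < #|'I_(sval n)| by rewrite card_ord (valP n).
have gA : group_set A.
  apply/group_setP; split=> [|p q /AP[pA Gp] /AP[qA Gq]]; apply/AP.
    split; first exact: group1.
    have := subgroup1 sG; rewrite (@embed_coord n k 1) //.
  by rewrite groupM // embedM //; split=> //; apply: subgroupM.
have nA : Group gA <| 'Alt_('I_(sval n)).
  apply/andP; split; first by apply/fintype.subsetP => q /AP[].
  apply/fintype.subsetP => p pA; rewrite finset.in_set.
  apply/fintype.subsetP => _ /imsetP[q /AP[qA Gq] ->]; apply/AP.
  rewrite groupJ //; split=> //.
  have [x Gx xE] := G_approx (embed k p) (sval n).+1.
  have := subgroupJ sG Gq Gx; rewrite [_ ^ x](@embed_coord n k).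
    by rewrite coordJ coord_embed // xE // coord_embed.
  by move=> n' k' out; rewrite coordJ coord_embed_out // conj1g.
have : Group gA :=: 'Alt_('I_(sval n)).
  apply: Alt_normal_subgroup => //.
  have [h [m [Gh h_lt h1]]] := G_detect k.
  have [q qA hq] := Alt_centerless n5 (coord_even h k) (introN eqP h1).
  (* [x] is prescribed on the factor [n] and on all factors below [m], and [h] is trivial from [m]
     on; so [[~ h, x]] is supported on the coordinate [k] alone. *)
  have [x Gx xE] := G_approx (embed k q) (maxn m (sval n).+1).
  apply/trivgPn; exists [~ coord h k, q] => //; apply/AP.
  rewrite groupR ?coord_even //; split=> //.
  have := subgroupR sG Gh Gx; rewrite [ [~ h, x] ](@embed_coord n k).
    by rewrite coordR xE ?coord_embed // leq_max ltnSn orbT.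
  move=> n' k' out; rewrite coordR; have [n'm|mn'] := ltnP (sval n') m.
    by rewrite xE ?coord_embed_out ?commg1 // leq_max n'm.
  by rewrite h_lt ?comm1g.
by move=> /= <- /AP[].
Qed.

Lemma G_supp_lt m g : supp_lt m g -> G g.
Proof.
move=> g_m; apply: (@embed_group_ind 0 G) g_m _ => // n k r _.
exact: G_embed.
Qed.

End Subgroup.
End Coordinates.

(** * Finite quotients of the dense subgroup kill a tail *)

Lemma finite_type_bound (Q : choiceType) : finite_set [set: Q] ->
  exists M, forall (T : finType) (phi : T -> Q), injective phi -> #|T| <= M.
Proof.
move=> /finite_seqP[s sE]; exists (size s) => T phi phi_inj.
rewrite cardE -(size_map phi); apply: uniq_leq_size.
  by rewrite map_inj_uniq // enum_uniq.
move=> q _; have : [set: Q] q by [].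
by rewrite sE.
Qed.

Lemma finite_torsion (Q : groupType) : finite_set [set: Q] ->
  forall q : Q, exists2 m, (0 < m)%N & q ^+ m = 1.
Proof.
move=> /finite_type_bound[M Mb] q.
have : ~ injective (fun i : 'I_M.+1 => q ^+ i).
  by move=> /Mb; rewrite card_ord ltnn.
move=> /existsNP[i /existsNP[j /not_implyP[Eij ij]]].
wlog lt_ij : i j Eij ij / (i < j)%N.
  move=> H; have [/H|/H|/val_inj //] := ltngtP i j; first exact.
  by apply=> //; apply: nesym.
exists (j - i)%N; first by rewrite subn_gt0.
by apply: (mulgI (q ^+ i)); rewrite -expgnDr subnKC ?mulg1 // ltnW.
Qed.

Lemma card_Alt_ge (T : finType) : 4 < #|T| -> #|T| <= #|'Alt_T|.
Proof.
move=> T5; have := card_Alt (ltn_trans _ T5) => /(_ isT).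
case: #|T| T5 => [|[|m]] // T5; rewrite !factS => E.
have := fact_gt0 m; nia.
Qed.

Section Tail.
Variable f : nat -> nat.
Local Notation P := (alternating_product f).
Local Notation idx := {n : nat | (5 <= n)%N}.
Implicit Types (g h : P) (n : idx).
Variable F : set P.
Let G := generated_subgroup F.
Hypothesis F_kill : self_killing F.
Hypothesis G_dense : forall g m, exists2 x, G x & supp_ge m (x^-1 * g).
Hypothesis G_detect : coord_detecting G.

Let sG : is_subgroup G := generated_is_subgroup F.

(** Large alternating groups die in [Q] by simplicity and cardinality. Hence [psi] composed with the
    truncation to [n > M] kills the finitely supported elements, and then all of [G] because [F] is
    self-killing. *)
Lemma kills_tail (Q : groupType) (psi : P -> Q) : finite_set [set: Q] ->
  (forall x y, G x -> G y -> psi (x * y) = psi x * psi y) ->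
  exists m, forall g, G g -> supp_ge m g -> psi g = 1.
Proof.
move=> Qfin psiM; have [M Mb] := finite_type_bound Qfin.
have G_emb := G_embed sG G_dense G_detect.
have G_supp := G_supp_lt sG G_dense G_detect.
have psi_embed n (k : 'I_(f (sval n))) r : (M < sval n)%N -> r \in 'Alt_('I_(sval n)) ->
    psi (embed k r) = 1.
  move=> Mn; have sA := Alt_is_subgroup 'I_(sval n).
  have n5 : 4 < #|'I_(sval n)| by rewrite card_ord (valP n).
  have phiM p q : p \in 'Alt_('I_(sval n)) -> q \in 'Alt_('I_(sval n)) ->
      psi (embed k (p * q)) = psi (embed k p) * psi (embed k q).
    by move=> pA qA; rewrite embedM // psiM //; apply: G_emb.
  pose A := finset (fun r : {perm 'I_(sval n)} =>
    (r \in 'Alt_('I_(sval n))) && `[< psi (embed k r) = 1 >]).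
  have AP q : reflect (q \in 'Alt_('I_(sval n)) /\ psi (embed k q) = 1) (q \in A).
    by rewrite [q \in A]finset.in_set; apply: (iffP andP) => -[qA /asboolP Gq].
  have gA : group_set A.
    apply/group_setP; split=> [|p q /AP[pA p1] /AP[qA q1]]; apply/AP.
      by split; [exact: group1|exact: (pmorph1 sA phiM)].
    by rewrite groupM // phiM // p1 q1 mulg1.
  have nA : Group gA <| 'Alt_('I_(sval n)).
    apply/andP; split; first by apply/fintype.subsetP => q /AP[].
    apply/fintype.subsetP => p pA; rewrite finset.in_set.
    apply/fintype.subsetP => _ /imsetP[q /AP[qA qE] ->]; apply/AP.
    by rewrite groupJ // (pmorphJ sA phiM) // qE conj1g.
  suff : Group gA :=: 'Alt_('I_(sval n)) by move=> /= <- /AP[].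
  (* Otherwise the alternating group, of order at least [n > M], would inject into [Q]. *)
  apply: Alt_normal_subgroup => //; apply/negP => /eqP A1.
  have := Mb {p : {perm 'I_(sval n)} | p \in 'Alt_('I_(sval n))}
             (fun p => psi (embed k (val p))).
  rewrite card_sig => H; suff : (sval n <= M)%N by rewrite leqNgt Mn.
  rewrite -[sval n]card_ord; apply: leq_trans (card_Alt_ge n5) (H _).
  move=> [p pA] [q qA] /= E; apply: val_inj => /=; apply/eqP; rewrite eq_mulgV1.
  have : p * q^-1 \in A.
    by apply/AP; rewrite groupM ?groupV // phiM ?groupV // (pmorphV sA phiM) // E mulgV.
  by have /= -> := A1; rewrite finset.in_set1.
have ker_sub : is_subgroup [set g | G g /\ psi g = 1].
  split=> [|x y [Gx x1] [Gy y1]|x [Gx x1]] /=.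
  - by split; [exact: (subgroup1 sG)|exact: (pmorph1 sG psiM)].
  - by split; [exact: (subgroupM sG)|rewrite psiM // x1 y1 mulg1].
  - by split; [exact: (subgroupV sG)|rewrite (pmorphV sG psiM) // x1 invg1].
have psi_supp m g : supp_lt m g -> supp_ge M.+1 g -> psi g = 1.
  move=> g_lt g_ge; have [] // := embed_group_ind ker_sub _ g_lt g_ge.
  by move=> n k r Mn rA; split; [exact: G_emb|exact: psi_embed].
pose tail := restr (fun n (_ : 'I_(f (sval n))) => (M < sval n)%N).
have tail_G g : G g -> G (tail g).
  (* [g] and [tail g] differ by a finitely supported element, and those lie in [G]. *)
  move=> Gg; rewrite (_ : tail g = (restr (fun n _ => (sval n <= M)%N) g)^-1 * g).
    apply: (subgroupM sG) => //; apply: (subgroupV sG); apply: (G_supp M.+1).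
    by move=> n Mn k; rewrite restrE leqNgt Mn.
  apply: coordP => n k; rewrite coordM coordV !restrE.
  by case: leqP; rewrite ?mulVg // invg1 mul1g.
have tail_M : {morph tail : g h / g * h} by exact: restrM.
have tail_kill g : G g -> psi (tail g) = 1.
  have F_tail x : F x -> psi (tail x) = 1.
    apply: (F_kill (Q := Q) (H := G) (psi := psi \o tail)) => //.
    - by move=> y z Gy Gz /=; rewrite tail_M psiM //; apply: tail_G.
    - exact: finite_torsion.
    - move=> m y Gy y_m /=; apply: (psi_supp m) => n n_m k; rewrite restrE.
        by rewrite y_m //; case: ifP.
      by rewrite ltnNge -ltnS n_m.
    - exact: sub_generated.
  suff : G `<=` [set g | G g /\ psi (tail g) = 1] by move=> H /H[].
  apply: generated_sub; last by move=> x Fx; split; [exact: sub_generated|exact: F_tail].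
  split=> [|x y [Gx x1] [Gy y1]|x [Gx x1]] /=.
  - split; first exact: (subgroup1 sG).
    rewrite /tail (_ : restr _ 1 = 1) ?(pmorph1 sG psiM) //.
    by apply: coordP => n k; rewrite restrE; case: ifP.
  - split; first exact: (subgroupM sG).
    by rewrite tail_M psiM ?x1 ?y1 ?mulg1 //; exact: tail_G.
  - split; first exact: (subgroupV sG).
    by rewrite /tail restrV (pmorphV sG psiM) ?x1 ?invg1 //; exact: tail_G.
exists M.+1 => g Gg g_ge; rewrite -[RHS](tail_kill g Gg); congr psi.
apply: coordP => n k; rewrite restrE; case: (ltnP M (sval n)) => // nM.
by rewrite g_ge // ltnS.
Qed.
End Tail.

(** * A criterion for being a profinite completion *)

Local Open Scope quotient_scope.

Section SubgroupType.
Variables (P : groupType) (G : set P) (sG : is_subgroup G).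

(* The type depends on the proof [sG], from which its group structure is inferred. *)
Definition subgroup_type : Type := let _ := sG in set_type G.
HB.instance Definition _ := Choice.on subgroup_type.

Definition subval (x : subgroup_type) : P := \val (x : set_type G).

Lemma subval_inj : injective subval.
Proof. by move=> x y E; apply: val_inj. Qed.

Lemma subvalP x : G (subval x).
Proof. exact: set_mem (valP (x : set_type G)). Qed.

Definition subin (p : P) (Gp : G p) : subgroup_type := SigSub (mem_set Gp).

Let mul (x y : subgroup_type) := subin (subgroupM sG (subvalP x) (subvalP y)).
Let one := subin (subgroup1 sG).
Let inv (x : subgroup_type) := subin (subgroupV sG (subvalP x)).

Fact sub_mulA : associative mul.
Proof. by move=> x y z; apply: subval_inj; apply: mulgA. Qed.
Fact sub_mul1 : left_id one mul.
Proof. by move=> x; apply: subval_inj; apply: mul1g. Qed.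
Fact sub_mulr1 : right_id one mul.
Proof. by move=> x; apply: subval_inj; apply: mulg1. Qed.
Fact sub_mulV : left_inverse one inv mul.
Proof. by move=> x; apply: subval_inj; apply: mulVg. Qed.
Fact sub_mulrV : right_inverse one inv mul.
Proof. by move=> x; apply: subval_inj; apply: mulgV. Qed.

HB.instance Definition _ := isGroup.Build subgroup_type
  sub_mulA sub_mul1 sub_mulr1 sub_mulV sub_mulrV.

End SubgroupType.

Lemma finite_setT_inj (T : Type) (K : finType) (r : T -> K) :
  injective r -> finite_set [set: T].
Proof.
move=> r_inj; rewrite -(preimage_setT r); apply: finite_preimage => //.
by move=> x y _ _; apply: r_inj.
Qed.

Section Completion.
Variables (P : topGroupType) (U : nat -> set P).
Hypothesis U_sub : forall m, is_subgroup (U m).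
Hypothesis U_conj : forall m x g, U m x -> U m (x ^ g).
Hypothesis U_mono : forall m m', (m <= m')%N -> U m' `<=` U m.
Hypothesis U_nbhs : forall x m, nbhs x [set y | U m (x^-1 * y)].
Hypothesis U_basis : forall x (W : set P), nbhs x W ->
  exists m, forall y, U m (x^-1 * y) -> W y.
Hypothesis U_sep : forall x, (forall m, U m x) -> x = 1.
Hypothesis U_fin : forall m, exists (K : finType) (r : P -> K),
  forall x y, r x = r y -> U m (x^-1 * y).
Hypothesis U_complete : forall s : nat -> P,
  (forall m, U m ((s m)^-1 * s m.+1)) -> exists p, forall m, U m ((s m)^-1 * p).

Variable F : set P.
Hypothesis F_fin : finite_set F.
Let G := generated_subgroup F.
Hypothesis G_dense : forall p m, exists2 x, G x & U m (x^-1 * p).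
Hypothesis G_tail : forall (Q : groupType) (psi : P -> Q), finite_set [set: Q] ->
  (forall x y, G x -> G y -> psi (x * y) = psi x * psi y) ->
  exists m, forall g, G g -> U m g -> psi g = 1.

Let Gam : groupType := subgroup_type (generated_is_subgroup F).
Let v : Gam -> P := @subval _ _ _.

Lemma Gam_fg : finitely_generated Gam.
Proof.
exists (v @^-1` F).
  by apply: finite_preimage F_fin => x y _ _; apply: subval_inj.
apply/seteqP; split=> // x _.
pose H := v @` generated_subgroup (v @^-1` F).
have sS := generated_is_subgroup (v @^-1` F).
have : G `<=` H.
  apply: generated_sub.
    split=> [|_ _ [y Sy <-] [z Sz <-]|_ [y Sy <-]].
    - by exists 1 => //; apply: (subgroup1 sS).
    - by exists (y * z) => //; apply: (subgroupM sS).
    - by exists y^-1 => //; apply: (subgroupV sS).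
  by move=> p Fp; exists (subin _ (sub_generated Fp)) => //; apply: sub_generated.
by move=> /(_ _ (subvalP x))[y Sy /subval_inj <-].
Qed.

Lemma U_inv m x : U m x -> U m x^-1. Proof. exact: (subgroupV (U_sub m)). Qed.
Lemma U_mul m x y : U m x -> U m y -> U m (x * y). Proof. exact: (subgroupM (U_sub m)). Qed.
Lemma U_sym m x y : U m (x^-1 * y) -> U m (y^-1 * x).
Proof. by move/U_inv; rewrite invgM invgK. Qed.
Lemma U_trans m x y z : U m (x^-1 * y) -> U m (y^-1 * z) -> U m (x^-1 * z).
Proof. by move=> xy yz; have := U_mul xy yz; rewrite mulgA mulgK. Qed.

Definition tail_normal (m : nat) : normal_subgroup Gam.
Proof.
refine (@NormalSubgroup Gam [set x | U m (v x)] _ _).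
  split=> [|x y Ux Uy|x Ux] /=; [exact: (subgroup1 (U_sub m))|exact: U_mul|exact: U_inv].
by move=> x g; apply: U_conj.
Defined.

Lemma tail_finite m : finite_set [set: quotient_group (tail_normal m)].
Proof.
have [K [r rP]] := U_fin m.
apply: (@finite_setT_inj _ K (fun u => r (v (repr u)))) => u u' /rP E.
by rewrite -(reprK u) -(reprK u'); apply/eq_coset.
Qed.

Definition tail m : finite_quotient Gam := FiniteQuotient (tail_finite m).

Lemma Gam_rf : residually_finite Gam.
Proof.
move=> g g1; apply/not_existsP => all_g; apply: g1; apply: subval_inj.
apply: U_sep => m; have := all_g (tail m).
by move=> /negP; rewrite negbK => /set_mem.
Qed.

(** The tails are cofinal among the normal subgroups of finite index, so the completion of [Gam] is
    a limit over the tails alone. *)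
Lemma tail_sub (N : finite_quotient Gam) :
  exists m, forall x : Gam, U m (v x) -> normal_set N x.
Proof.
(* [G_tail] speaks of functions on [P], so the quotient map is extended by 1 outside [G]. *)
pose psi (p : P) : quotient_group N :=
  if pselect (G p) is left Gp then \pi_(quotient_group N) (subin _ Gp : Gam) else 1.
have psiE (x : Gam) : psi (v x) = \pi_(quotient_group N) x.
  rewrite /psi; case: pselect => [Gp|/(_ (subvalP x))//].
  by congr (\pi _); apply: subval_inj.
have [|m mP] := G_tail (finite_quotient_finite N) (psi := psi).
  have vP p : G p -> exists x : Gam, v x = p by move=> Gp; exists (subin _ Gp).
  move=> _ _ /vP[x <-] /vP[y <-].
  by rewrite -[v x * v y]/(v (x * y)) !psiE quotient_piM.
exists m => x Ux; have := mP _ (subvalP x) Ux; rewrite psiE => E.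
have /eq_coset : \pi_(quotient_group N) (1 : Gam) = \pi_(quotient_group N) x by rewrite E.
by rewrite invg1 mul1g.
Qed.

Definition approx p m : Gam :=
  let: exist2 x Gx _ := cid2 (G_dense p m) in subin _ Gx.
Lemma approxP p m : U m ((v (approx p m))^-1 * p).
Proof. by rewrite /approx; case: cid2. Qed.

Definition to_completion_fun (p : P) (N : finite_quotient Gam) : quotient_group N :=
  \pi_(quotient_group N) (approx p (sval (cid (tail_sub N)))).

(** The class does not depend on the choices: two approximations of [p] agree at the coarser of
    their levels, and that level is already fine enough for [N]. *)
Lemma to_completion_funE p (N : finite_quotient Gam) m (x : Gam) :
  (forall y : Gam, U m (v y) -> normal_set N y) -> U m ((v x)^-1 * p) ->
  to_completion_fun p N = \pi_(quotient_group N) x.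
Proof.
move=> mN Ux; rewrite /to_completion_fun; case: cid => m' m'N /=.
have Uy := approxP p m'; move: (approx p m') Uy => y Uy.
apply/eq_coset; have [mm'|m'm] := leqP m m'.
  by apply: mN; apply: (U_trans (U_mono mm' Uy)); apply: U_sym.
by apply: m'N; apply: (U_trans Uy); apply: U_sym; apply: (U_mono (ltnW m'm)).
Qed.

Lemma to_completion_coherent p :
  coherent (to_completion_fun p : prod_topology
    (fun N : finite_quotient Gam => discrete_topology (quotient_group N))).
Proof.
move=> N M NM; have [m mN] := tail_sub N.
rewrite (to_completion_funE mN (approxP p m)).
rewrite (@to_completion_funE p M m (approx p m)) ?quotient_map_pi //.
- by move=> y /mN/NM.
- exact: approxP.
Qed.

Definition to_completion (p : P) : profinite_completion Gam :=
  SigSub (mem_set (to_completion_coherent p)).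

Lemma to_completionM : {morph to_completion : p q / p * q}.
Proof.
move=> p q; apply: val_inj; apply: functional_extensionality_dep => N.
have [m mN] := tail_sub N.
pose x := approx p m; pose y := approx q m.
transitivity (\pi_(quotient_group N) (x * y)).
  apply: to_completion_funE mN _.
  have -> : (v (x * y))^-1 * (p * q) = (((v x)^-1 * p) ^ v y) * ((v y)^-1 * q).
    by rewrite [v _]/(v x * v y) conjgE invgM !mulgA mulgK.
  by apply: U_mul; [apply: U_conj|]; apply: approxP.
rewrite quotient_piM; congr (_ * _); apply/esym; apply: to_completion_funE mN _;
  exact: approxP.
Qed.

Lemma to_completion_continuous : continuous to_completion.
Proof.
pose W : topGroupType := prod_topology
  (fun N : finite_quotient Gam => discrete_topology (quotient_group N)).
apply: (@continuous_comp_initial _ _ W (fun x : profinite_completion Gam => \val x)).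
apply: prod_continuous => N p A /principal_filterP Ap.
have [m mN] := tail_sub N.
apply: filterS (U_nbhs p m) => q Uq /=.
rewrite /to_completion /= in Ap *.
rewrite (to_completion_funE mN (approxP p m)) in Ap.
by rewrite (@to_completion_funE q N m (approx p m)) //; apply: U_trans Uq; apply: approxP.
Qed.

Section FromCompletion.
Variable c : profinite_completion Gam.

Let s (m : nat) : P := v (repr ((\val c) (tail m))).

(** By coherence, the representatives chosen at successive tails agree to higher and higher order,
    so [U_complete] provides a limit. *)
Lemma from_completion_ex : exists p, forall m, U m ((s m)^-1 * p).
Proof.
apply: U_complete => m.
have c_coh := set_mem (valP c).
have := c_coh (tail m.+1) (tail m) (fun x => @U_mono m m.+1 (leqnSn m) (v x)).
rewrite -[in RHS](reprK (\val c (tail m))) => /esym/eq_coset; exact.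
Qed.

Definition from_completion : P := sval (cid from_completion_ex).

Lemma from_completionP m : U m ((s m)^-1 * from_completion).
Proof. exact: (svalP (cid from_completion_ex)). Qed.
End FromCompletion.

Lemma to_completionK : cancel to_completion from_completion.
Proof.
move=> p; apply: (mulgI (from_completion (to_completion p))^-1).
rewrite mulVg; apply/esym/U_sep => m.
apply: U_trans (U_sym (from_completionP (to_completion p) m)) _.
apply: U_trans (approxP p m); apply: U_sym.
apply: (proj1 (eq_coset (tail_normal m) (approx p m) _)).
rewrite reprK; apply/esym.
exact: (@to_completion_funE p (tail m) m (approx p m) (fun y Uy => Uy) (approxP p m)).
Qed.

Lemma from_completionK : cancel from_completion to_completion.
Proof.
move=> c; apply: val_inj; apply: functional_extensionality_dep => N.
have [m mN] := tail_sub N; have c_coh := set_mem (valP c).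
rewrite -(c_coh (tail m) N mN).
by apply: to_completion_funE mN _; apply: from_completionP.
Qed.

(** Agreement with [c] in the component [tail m] is an open condition, and it determines the limit
    modulo [U m]. *)
Lemma from_completion_continuous : continuous from_completion.
Proof.
move=> c W /U_basis[m mW].
pose Pr : topGroupType := prod_topology
  (fun N : finite_quotient Gam => discrete_topology (quotient_group N)).
have c_proj : continuous (fun x : profinite_completion Gam => (\val x : Pr) (tail m)).
  move=> x; apply: (@continuous_comp _ _ _ (fun x : profinite_completion Gam => \val x : Pr)
    (fun x : Pr => x (tail m))); first exact: (@initial_continuous _ Pr).
  exact: prod_proj_continuous.
have near_c : nbhs c [set c' | (\val c' : Pr) (tail m) = (\val c : Pr) (tail m)].
  exact: (c_proj c [set (\val c : Pr) (tail m)] (discrete_set1 _)).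
apply: (@filterS _ (nbhs c) _ _ _ _ near_c) => c' /= cc'; apply: mW.
have := from_completionP c m; have := from_completionP c' m; rewrite /= cc'.
by move=> U' /U_sym Uc; apply: U_trans Uc U'.
Qed.

Lemma profinite_completion_of_dense : is_profinite_completion P.
Proof.
exists Gam; split; [exact: Gam_fg|exact: Gam_rf|].
exists to_completion, from_completion; split.
- exact: to_completionK.
- exact: from_completionK.
- exact: to_completionM.
- exact: to_completion_continuous.
- exact: from_completion_continuous.
Qed.
End Completion.

(** * The topology of the Cartesian product *)

Lemma cvg_prod_topology (I : Type) (T : I -> topologicalType)
    (F : set_system (prod_topology T)) (x : prod_topology T) :
  Filter F -> (forall i A, nbhs (x i) A -> F [set y | A (y i)]) -> F --> x.
Proof.
move=> FF Fx; apply/cvg_sup => i A; rewrite nbhsE => -[B [[C Copen <-] Cx] BA].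
by apply: filterS BA _; apply: Fx; apply: open_nbhs_nbhs; split.
Qed.

Section Topology.
Variable f : nat -> nat.
Local Notation P := (alternating_product f).
Local Notation idx := {n : nat | (5 <= n)%N}.
Local Notation U := (@supp_ge f).
Implicit Types (x y : P) (n : idx).

Lemma supp_ge_subgroup m : is_subgroup (U m).
Proof.
split=> [n _ k|x y Ux Uy n nm k|x Ux n nm k] //.
  by rewrite coordM Ux ?Uy ?mulg1.
by rewrite coordV Ux ?invg1.
Qed.

Lemma supp_ge_conj m x g : U m x -> U m (x ^ g).
Proof. by move=> Ux n nm k; rewrite coordJ Ux ?conj1g. Qed.

Lemma supp_ge_mono m m' : (m <= m')%N -> U m' `<=` U m.
Proof. by move=> mm' x Ux n nm k; apply: Ux; apply: leq_trans mm'. Qed.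

Lemma supp_geP m x y :
  U m (x^-1 * y) <-> forall n (k : 'I_(f (sval n))), (sval n < m)%N -> coord x k = coord y k.
Proof.
split=> [xy n k nm|xy n nm k]; last by rewrite coordM coordV (xy n k nm) mulVg.
by apply/eqP; rewrite eq_mulVg1 -coordV -coordM xy.
Qed.

(** Only finitely many pairs [(n, k)] have [n < m], and each coordinate is a continuous map to a
    discrete space. *)
Lemma supp_ge_nbhs x m : nbhs x [set y | U m (x^-1 * y)].
Proof.
have near_i (i : 'I_m) : nbhs x [set y | forall n, sval n = i ->
    forall k : 'I_(f (sval n)), coord x k = coord y k].
  have [i5|i5] := leqP 5 i; last first.
    apply: filterS filterT => y _ n ni; exfalso.
    by have := valP n; rewrite /= leqNgt ni i5.
  pose n : idx := exist _ (i : nat) i5.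
  have near_k : \forall y \near x, forall k : 'I_(f (sval n)), coord x k = coord y k.
    apply: (@filter_forall _ _ _ (nbhs x)) => k.
    have c2 : continuous (fun y : P => y n k).
      move=> z; apply: (@continuous_comp _ _ _ (fun y : P => y n)
        (fun u : power_group (alternating_group (sval n)) (f (sval n)) => u k)).
        exact: prod_proj_continuous.
      exact: prod_proj_continuous.
    have near_x : nbhs x [set y | y n k = x n k].
      exact: (c2 x [set x n k] (discrete_set1 _)).
    by apply: (@filterS _ (nbhs x) _ _ _ _ near_x) => y /= xy; rewrite /coord xy.
  apply: (@filterS _ (nbhs x) _ _ _ _ near_k) => y /= xy n' n'i.
  by have -> : n' = n by apply: val_inj.
have near_all : \forall y \near x, forall (i : 'I_m) n, sval n = i ->
    forall k : 'I_(f (sval n)), coord x k = coord y k.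
  exact: (@filter_forall _ _ _ (nbhs x)).
apply: (@filterS _ (nbhs x) _ _ _ _ near_all) => y /= xy.
by apply/supp_geP => n k nm; apply: (xy (Ordinal nm)).
Qed.

Lemma supp_ge_basis x (W : set P) : nbhs x W ->
  exists m, forall y, U m (x^-1 * y) -> W y.
Proof.
(* [F] consists of the sets that contain some coset [x U m]; it remains to see that it converges to
   [x], which is tested coordinatewise. *)
pose F : set_system P := [set A | exists m, forall y, U m (x^-1 * y) -> A y].
have FF : Filter F.
  split=> [|A B [m mA] [m' m'B]|A B AB [m mA]].
  - by exists 0.
  - exists (maxn m m') => y Uy; split.
      by apply/mA/(supp_ge_mono (leq_maxl m m') Uy).
    by apply/m'B/(supp_ge_mono (leq_maxr m m') Uy).
  - by exists m => y /mA/AB.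
suff : F --> x by apply.
apply: cvg_prod_topology => n A xA.
have : (fun y => y n) @ F --> x n.
  apply: cvg_prod_topology => k B /principal_filterP Bx.
  exists (sval n).+1 => y /supp_geP/(_ n k (ltnSn _)) xy /=.
  suff <- : x n k = y n k by [].
  exact: val_inj.
exact.
Qed.

Lemma supp_ge_sep x : (forall m, U m x) -> x = 1.
Proof. by move=> Ux; apply: coordP => n k; apply: (Ux (sval n).+1). Qed.

Lemma supp_ge_fin m : exists (K : finType) (r : P -> K),
  forall x y, r x = r y -> U m (x^-1 * y).
Proof.
pose J := {i : 'I_m | 5 <= i}.
pose nJ (i : J) : idx := exist _ (nat_of_ord (sval i)) (svalP i).
pose r x : {dffun forall i : J, {ffun 'I_(f (sval (nJ i))) -> {perm 'I_(sval (nJ i))}}} :=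
  [ffun i => [ffun k => coord x k]].
exists _, r => x y rxy; apply/supp_geP => n k nm.
pose j : J := exist _ (Ordinal nm) (valP n).
have E : n = nJ j by apply: val_inj.
by move: k; rewrite E => k; have /ffunP/(_ j)/ffunP/(_ k) := rxy; rewrite !ffunE.
Qed.

Lemma supp_ge_complete (s : nat -> P) :
  (forall m, U m ((s m)^-1 * s m.+1)) -> exists p, forall m, U m ((s m)^-1 * p).
Proof.
(* The diagonal limit: from index [n + 1] on, the factor [n] of the sequence no longer changes. *)
move=> sU; exists (fun n => s (sval n).+1 n) => m; apply/supp_geP => n k nm.
rewrite -[RHS]/(coord (s (sval n).+1) k).
elim: m nm => // m IH; rewrite ltnS leq_eqVlt => /orP[/eqP nm|nm].
  by have -> : s (sval n).+1 = s m.+1 by rewrite nm.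
by rewrite -IH //; have /supp_geP/(_ n k nm) := sU m.
Qed.

End Topology.

Theorem theorem2 (f : nat -> nat) :
  topologically_finitely_generated (alternating_product f) ->
  is_profinite_completion (alternating_product f).
Proof.
move=> /exists_generators[F [F_fin F_kill F_dense F_detect]].
have G_dense p m : exists2 x, generated_subgroup F x & supp_ge m (x^-1 * p).
  have := supp_ge_nbhs p m; rewrite nbhsE => -[B [B_open Bp] BU].
  have [|x [/BU Ux Gx]] := F_dense B _ B_open; first by exists p.
  exists x => //; apply/supp_geP => n k nm; apply/esym.
  by have /supp_geP := Ux; apply.
apply: (@profinite_completion_of_dense _ (@supp_ge f) _ _ _ _ _ _ _ _ F) => //.
- exact: supp_ge_subgroup.
- exact: supp_ge_conj.
- exact: supp_ge_mono.
- exact: supp_ge_nbhs.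
- exact: supp_ge_basis.
- exact: supp_ge_sep.
- exact: supp_ge_fin.
- exact: supp_ge_complete.
- by move=> Q psi Qfin psiM; apply: kills_tail.
Qed.
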